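(* Let $\mu\in(0,\frac12]$ and let $V\in C^\infty(\mathbb{R}^2)$ be a non-negative function such that, in polar coordinates $(r,\theta)$ on $\mathbb{R}^2$, for all $r\ge 1$ and all $\theta$, $$V(r,\theta)=\frac{1-\mu}{\sqrt{r^2+2r\mu\cos\theta+\mu^2}}+\frac{\mu}{\sqrt{r^2-2r(1-\mu)\cos\theta+(1-\mu)^2}} .$$ Let $H:T^*\mathbb{R}^2\to\mathbb{R}$ be $H(q,p)=\frac12(p_1^2+p_2^2)+p_1q_2-p_2q_1-V(q)$. Let $q_0,q_1\in\mathbb{R}^2$ be any pair of points and put $$R_1:=\max\{2(1-\mu),|q_0|,|q_1|\},\qquad a:=\frac{(1-\mu)R_1}{R_1-\mu}+\frac{\mu R_1}{R_1-(1-\mu)} .$$ Let $$c>\max\left\{\sqrt[3]{32a^2},\ \sqrt{4a\left(3R_1+2\sqrt[3]{2a}\right)}\right\}.$$ Then there exists $(v,\eta)\in W^{1,2}([0,1],T^*\mathbb{R}^2)\times\mathbb{R}$ such that $$\partial_tv=\eta X_H(v),\qquad v([0,1])\subseteq H^{-1}(c),\qquad v(i)\in T^*_{q_i}\mathbb{R}^2\ \text{ for } i=0,1,$$ and $v([0,1])\subseteq T^*B(R_1)$, where $B(R_1)\subseteq\mathbb{R}^2$ is the closed ball of radius $R_1$ centered at the origin.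
   Context: $T^*\mathbb{R}^2\cong\mathbb{R}^2\times\mathbb{R}^2$ has coordinates $(q,p)=(q_1,q_2,p_1,p_2)$ (inside the formula for $H$, $q_1,q_2$ denote the coordinates of the position $q$; elsewhere $q_0,q_1$ are the two end points in $\mathbb{R}^2$). It carries the symplectic form $\omega=d\lambda$, $\lambda=p\,dq$. The Hamiltonian vector field is $X_H=\sum_i\left(\partial_{p_i}H\,\partial_{q_i}-\partial_{q_i}H\,\partial_{p_i}\right)$. For $A\subseteq\mathbb{R}^2$, $T^*A$ denotes $\{(q,p)\in T^*\mathbb{R}^2: q\in A\}$, and $T^*_{q_i}\mathbb{R}^2$ is the fiber over $q_i$. $W^{1,2}$ denotes the Sobolev space of maps with one weak derivative in $L^2$. *)

(* Defs.v *)
From HB Require Import structures.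
From mathcomp Require Import all_boot all_order all_algebra.
From mathcomp Require Import all_classical all_reals all_analysis.

Set Implicit Arguments.
Unset Strict Implicit.
Unset Printing Implicit Defensive.

Import Order.TTheory GRing.Theory Num.Theory.
Import numFieldNormedType.Exports.

Local Open Scope classical_set_scope.
Local Open Scope ring_scope.

(* The library norm on 'rV[R]_n is the sup norm, hence this Euclidean one. *)
Definition enorm (R : realType) (n : nat) (q : 'rV[R]_n) : R :=
  Num.sqrt (\sum_(i < n) q 0 i ^+ 2).

Definition closed_eball (R : realType) (r : R) : set 'rV[R]_2 :=
  [set q | enorm q <= r].

Definition polar (R : realType) (r theta : R) : 'rV[R]_2 :=
  \row_(i < 2) (if i == 0 then r * cos theta else r * sin theta).

Definition partial (R : realType) (n : nat) (i : 'I_n.+1)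
    (f : 'rV[R]_n.+1 -> R) : 'rV[R]_n.+1 -> R :=
  fun x => 'D_(delta_mx 0 i) f x.

Fixpoint Ck (R : realType) (n k : nat) (f : 'rV[R]_n.+1 -> R) : Prop :=
  continuous f /\
  if k is k'.+1 then
    forall i : 'I_n.+1,
      (forall x, derivable f x (delta_mx 0 i)) /\ Ck k' (partial i f)
  else True.

Definition smooth (R : realType) (n : nat) (f : 'rV[R]_n.+1 -> R) : Prop :=
  forall k, Ck k f.

(* T^*R^2 = R^2 * R^2, a point being the pair (q, p). *)
Definition cotangent (R : realType) : normedModType R :=
  ('rV[R]_2 * 'rV[R]_2)%type.

Definition cotangent_over (R : realType) (A : set 'rV[R]_2) :
  set (cotangent R) := [set x | A x.1].

Definition hamiltonian (R : realType) (V : 'rV[R]_2 -> R)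
    (x : cotangent R) : R :=
  let: (q, p) := x in
  (p 0 0 ^+ 2 + p 0 1 ^+ 2) / 2 + p 0 0 * q 0 1 - p 0 1 * q 0 0 - V q.

Definition hamiltonian_vector_field (R : realType) (H : cotangent R -> R)
    (x : cotangent R) : cotangent R :=
  (\row_(i < 2) 'D_((0, delta_mx 0 i) : cotangent R) H x,
   \row_(i < 2) - 'D_((delta_mx 0 i, 0) : cotangent R) H x).

(* A closed subset of R contained in ]0, 1[ is compact, so these are the
   elements of C_c^oo(]0, 1[). *)
Definition test_function01 (R : realType) (phi : R -> R) : Prop :=
  (forall (k : nat) (t : R), derivable (phi^`(k)%classic) t 1) /\
  closure [set t | phi t != 0] `<=` `]0, 1[.

Definition weak_derivative01 (R : realType) (u g : R -> R) : Prop :=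
  [/\ locally_integrable `]0, 1[ u, locally_integrable `]0, 1[ g &
      forall phi : R -> R, test_function01 phi ->
        \int[lebesgue_measure]_(t in `]0, 1[) (u t * phi^`()%classic t) =
        - \int[lebesgue_measure]_(t in `]0, 1[) (g t * phi t)].

Definition L2_01 (R : realType) (u : R -> R) : Prop :=
  measurable_fun (`]0, 1[ : set R) u /\
  (\int[lebesgue_measure]_(t in `]0%R, 1%R[) ((u t ^+ 2)%R)%:E < +oo)%E.

Definition W12_01 (R : realType) (u : R -> R) : Prop :=
  L2_01 u /\ exists g : R -> R, L2_01 g /\ weak_derivative01 u g.

Definition curve_weak_derivative (R : realType) (v w : R -> cotangent R) :
    Prop :=
  forall i : 'I_2,
    weak_derivative01 (fun t => (v t).1 0 i) (fun t => (w t).1 0 i) /\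
    weak_derivative01 (fun t => (v t).2 0 i) (fun t => (w t).2 0 i).

(* Only the values of [v] on [0, 1] matter.  Elements of W^{1,2} are classes
   modulo a.e. equality; continuity selects the representative for which the
   values at 0 and 1 and the image of [0, 1] are meaningful. *)
Definition W12_curve (R : realType) (v : R -> cotangent R) : Prop :=
  {within `[0, 1], continuous v} /\
  forall i : 'I_2,
    W12_01 (fun t => (v t).1 0 i) /\ W12_01 (fun t => (v t).2 0 i).

(* Main.v *)
Require Import Defs.
From HB Require Import structures.
From mathcomp Require Import all_boot all_order all_algebra.
From mathcomp Require Import all_classical all_reals all_analysis.
From mathcomp Require Import ring lra.

(** Put [A q = (q_2, - q_1)].  Then [H = |p|^2/2 + p.Aq - V], so [q' = p + Aq],
    and the orbits of energy [c] are the critical points, with free time [T], of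
    the action [int_0^T (|p|^2/2 + V + c) dt] with [p = q' - Aq].  Its integrand
    is at least [c > 0].  Discretise time into [N] steps of free length [tau]:
    a minimiser exists by compactness, it satisfies a semi-implicit Euler scheme
    for Hamilton's equations, and its mean energy is [c].  The bounds on [T], [q]
    and [p] do not depend on [N], so the polygons are equi-Lipschitz and their
    limit along an ultrafilter is a classical orbit of energy [c].

    To stay in the disc, replace [V] outside of it by [V + K (|q|^2 - R1^2)^2]
    before minimising.  With [e = 2a/R1] one has [q.grad V >= - e] outside the
    disc, whereas for [K] large energy [c] forces [|p|^2 > e] there.  Hence
    [(q.p)' = T (|p|^2 + q.grad V) > 0] outside the disc.  As [(|q|^2)' = 2T q.p],
    the function [|q|^2] has no interior maximum there, so the orbit does not leave
    the disc, where the potential is unchanged. *)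

Set Implicit Arguments.
Unset Strict Implicit.
Unset Printing Implicit Defensive.

Import Order.TTheory GRing.Theory Num.Theory.
Import numFieldNormedType.Exports.

Local Open Scope classical_set_scope.
Local Open Scope ring_scope.

(** The integrand is the Legendre transform [|q' - Aq|^2/2 + V] of [H], plus [c]; stationarity in
    the free time is the condition [H = c]. Since [V >= 0] enters [H] with a minus sign, the
    integrand is positive, which bounds [T] above. A bound from below needs distinct end points:
    otherwise the minimising time could collapse to 0. For equal end points a constant curve with
    [eta = 0], at a point of energy [c] in the fibre, solves the problem. The discretisation reduces
    the variational part to one-variable derivatives, in a single vertex or in [tau]. The limit
    solves the equations classically, so its Sobolev regularity comes down to integration by parts.
    The penalty also makes the potential coercive: it dominates [|x|] and [|y|] up to a constant.
    This pays for the drift [Aq] in the bounds on positions. The constant [e] bounds the radial pull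
    of the primaries: outside the disc their distance is at least half of [|q|]. The assumption on
    [c] gives [c^2 >= 12 a R1], hence a gap [c - (e/2 + sqrt e * R1) > 0], and [K] is [e] divided by
    this gap. *)

Section Sums.
Variable R : realType.
Implicit Types (f g : nat -> R).

(** Summing over all steps, not only those between [i] and [j], gives one bound for every pair of
    vertices, and it is the total sum that the action controls. *)
Lemma norm_telescope_le f g (N i j : nat) : (i <= N)%N -> (j <= N)%N ->
  (forall k, (k < N)%N -> `|f k.+1 - f k| <= g k) ->
  `|f j - f i| <= \sum_(k < N) g k.
Proof.
move=> iN jN fg; have g0 k : (k < N)%N -> 0 <= g k.
  by move=> kN; apply: le_trans (fg k kN).
wlog ij : i j iN jN / (i <= j)%N.
  by case: (leqP i j) => [|/ltnW] ? h; [exact: h|rewrite distrC; exact: h].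
rewrite -telescope_sumr// (le_trans (ler_norm_sum _ _ _))//.
rewrite -(big_mkord xpredT g) [in leRHS](@big_cat_nat _ _ _ i)//=.
rewrite [in leRHS](@big_cat_nat _ _ _ j i N)//= addrCA.
rewrite -[leLHS]addr0 lerD//.
  by apply: ler_sum_nat => k /andP[_ kj]; apply/fg/(leq_trans kj).
apply: addr_ge0; rewrite big_nat_cond sumr_ge0// => k; rewrite andbT.
  by case/andP=> _ ki; apply/g0/(leq_trans ki).
by case/andP=> _ ki; apply/g0.
Qed.

(** Moving the single vertex [j.+1] touches only the steps [j] and [j.+1], so this computes the
    resulting change of the action. *)
Lemma sum_local2 f g (N j : nat) : (j.+1 < N)%N ->
  (forall k, (k < N)%N -> k != j -> k != j.+1 -> f k = g k) ->
  \sum_(k < N) f k - \sum_(k < N) g k = (f j + f j.+1) - (g j + g j.+1).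
Proof.
move=> jN fg; rewrite -!(big_mkord xpredT).
have E (h : nat -> R) : \sum_(0 <= k < N) h k = (h j + h j.+1) +
    (\sum_(0 <= k < j) h k + \sum_(j.+2 <= k < N) h k).
  have jN' : (j <= N)%N by do 2 apply: ltnW.
  rewrite (big_cat_nat (n := j))//= (big_ltn (m := j) (n := N)) ?(ltnW jN)//.
  by rewrite (big_ltn (m := j.+1))//; ring.
rewrite !E.
have -> : \sum_(0 <= k < j) f k = \sum_(0 <= k < j) g k.
  apply: eq_big_nat => k /andP[_ kj]; have jN' := ltnW jN.
  rewrite fg ?neq_ltn ?kj ?(ltn_trans kj) //.
have -> : \sum_(j.+2 <= k < N) f k = \sum_(j.+2 <= k < N) g k.
  apply: eq_big_nat => k /andP[jk kN].
  by rewrite fg// neq_ltn ?jk ?(ltnW jk) orbT.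
ring.
Qed.

Lemma sum_const_ord (N : nat) (b : R) : \sum_(k < N) b = N%:R * b.
Proof. by rewrite sumr_const card_ord mulr_natl. Qed.

Lemma exists_ge_mean f (N : nat) (b : R) : (0 < N)%N ->
  N%:R * b <= \sum_(k < N) f k -> exists2 k, (k < N)%N & b <= f k.
Proof.
move=> N0 le_sum; apply: contrapT => no.
suff: \sum_(k < N) f k < N%:R * b by rewrite ltNge le_sum.
rewrite -sum_const_ord; apply: ltr_sum.
  by apply/hasP; exists (Ordinal N0) => //; rewrite mem_index_enum.
by move=> k _; rewrite ltNge; apply/negP => ?; apply: no; exists k.
Qed.

End Sums.

(** * Discrete action *)

(* The momentum [q' - Aq] of the polygon with vertices [(X k, Y k)] and time step [tau]. *)
Definition disc_px (R : realType) (tau : R) (X Y : nat -> R) (k : nat) : R :=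
  (X k.+1 - X k) / tau - Y k.

Definition disc_py (R : realType) (tau : R) (X Y : nat -> R) (k : nat) : R :=
  (Y k.+1 - Y k) / tau + X k.

(** The Lagrangian plus [c]. Everything but the velocity is taken at the left end of the step. This
    is what makes the scheme semi-implicit: positions are updated with the values at the old vertex,
    momenta with those at the new one. *)
Definition disc_lag (R : realType) (W : R -> R -> R) (c tau : R)
    (X Y : nat -> R) (k : nat) : R :=
  disc_px tau X Y k ^+ 2 / 2 + disc_py tau X Y k ^+ 2 / 2 + W (X k) (Y k) + c.

Definition disc_action (R : realType) (W : R -> R -> R) (c : R) (N : nat)
    (tau : R) (X Y : nat -> R) : R :=
  \sum_(k < N) tau * disc_lag W c tau X Y k.

(** * A priori bounds in terms of the action *)

Section APriori.
Variables (R : realType) (W : R -> R -> R) (c C0 : R).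
Hypotheses (W_ge0 : forall x y, 0 <= W x y) (c_gt0 : 0 < c) (C0_ge0 : 0 <= C0).
Hypotheses (xW : forall x y, `|x| <= W x y + C0)
  (yW : forall x y, `|y| <= W x y + C0).
Variables (N : nat) (tau M : R) (X Y : nat -> R).
Hypotheses (tau_gt0 : 0 < tau) (SM : disc_action W c N tau X Y <= M).

Let T := N%:R * tau.
Local Notation e := (disc_lag W c tau X Y).
Local Notation px := (disc_px tau X Y).
Local Notation py := (disc_py tau X Y).

Lemma weighted_sum_le (f : nat -> R) (al be : R) : 0 <= al ->
  (forall k, (k < N)%N -> f k <= al * e k + be) ->
  \sum_(k < N) tau * f k <= al * M + be * T.
Proof.
move=> al0 fe.
apply: (@le_trans _ _ (\sum_(k < N) (al * (tau * e k) + tau * be))).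
  apply: ler_sum => k _; rewrite mulrCA -mulrDr ler_pM2l//; exact: fe.
rewrite big_split/= -mulr_sumr sum_const_ord.
have -> : N%:R * (tau * be) = be * T by rewrite /T; ring.
by rewrite lerD2r ler_wpM2l.
Qed.

Lemma lag_parts k : [/\ 0 <= px k ^+ 2, 0 <= py k ^+ 2 &
  0 <= W (X k) (Y k)].
Proof. by rewrite !sqr_ge0 W_ge0. Qed.

(** Young's inequality. The weight [b] is kept free, since the lower bound on the time needs it
    matched to the distance of the end points. *)
Lemma abs_le_sqr (x b : R) : 0 < b -> `|x| <= b * (x ^+ 2 / 2) + (2 * b)^-1.
Proof.
move=> b0; rewrite -(@ler_pM2l _ (2 * b)) ?mulr_gt0// mulrDr mulfV ?gt_eqF ?mulr_gt0//.
rewrite -(real_normK (num_real x)).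
have := sqr_ge0 (b * `|x| - 1); nra.
Qed.

Lemma abs_px_le k b : 0 < b -> `|px k| <= b * e k + (2 * b)^-1.
Proof.
move=> b0; apply: (le_trans (abs_le_sqr _ b0)); rewrite lerD2r ler_pM2l//.
by have [? ? ?] := lag_parts k; rewrite /e; have := c_gt0; lra.
Qed.

Lemma abs_py_le k b : 0 < b -> `|py k| <= b * e k + (2 * b)^-1.
Proof.
move=> b0; apply: (le_trans (abs_le_sqr _ b0)); rewrite lerD2r ler_pM2l//.
by have [? ? ?] := lag_parts k; rewrite /e; have := c_gt0; lra.
Qed.

Lemma time_le : T <= M / c.
Proof.
rewrite ler_pdivlMr//.
have := @weighted_sum_le (fun=> c) 1 0 ler01.
rewrite sum_const_ord mul1r mul0r addr0 /T -mulrA => -> // k _.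
by have [? ? ?] := lag_parts k; rewrite /e; lra.
Qed.

Lemma step_xE k : X k.+1 - X k = tau * (px k + Y k).
Proof. by rewrite /disc_px subrK mulrCA mulfV ?mulr1// gt_eqF. Qed.

Lemma step_yE k : Y k.+1 - Y k = tau * (py k - X k).
Proof. by rewrite /disc_py addrK mulrCA mulfV ?mulr1// gt_eqF. Qed.

Let D := M + (2^-1 + C0) * (M / c).

Lemma osc_le (f g : nat -> R) :
  (forall k, (k < N)%N -> g k <= e k + (2^-1 + C0)) ->
  (forall k, (k < N)%N -> `|f k.+1 - f k| <= tau * g k) ->
  forall i j, (i <= N)%N -> (j <= N)%N -> `|f j - f i| <= D.
Proof.
move=> ge fg i j iN jN; rewrite (le_trans (norm_telescope_le iN jN fg))//.
apply: (@le_trans _ _ (1 * M + (2^-1 + C0) * T)); first apply: weighted_sum_le => //.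
  by move=> k kN; rewrite mul1r; exact: ge.
by rewrite /D mul1r lerD2l ler_wpM2l ?time_le// addr_ge0// invr_ge0.
Qed.

(** The velocity is [px + Y]: the kinetic term controls [px] and the growth of [W] controls the
    drift [Y], so no prior bound on the position enters. *)
Lemma X_osc i j : (i <= N)%N -> (j <= N)%N -> `|X j - X i| <= D.
Proof.
apply: (@osc_le X (fun k => `|px k| + `|Y k|)) => k _.
  have [? ? ?] := lag_parts k; have := @abs_le_sqr (px k) 1 ltr01.
  by have := yW (X k) (Y k); rewrite /e mul1r mulr1; have := c_gt0; lra.
by rewrite step_xE normrM gtr0_norm// ler_pM2l// ler_normD.
Qed.

Lemma Y_osc i j : (i <= N)%N -> (j <= N)%N -> `|Y j - Y i| <= D.
Proof.
apply: (@osc_le Y (fun k => `|py k| + `|X k|)) => k _.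
  have [? ? ?] := lag_parts k; have := @abs_le_sqr (py k) 1 ltr01.
  by have := xW (X k) (Y k); rewrite /e mul1r mulr1; have := c_gt0; lra.
by rewrite step_yE normrM gtr0_norm// ler_pM2l// ler_normB.
Qed.

(** Meant for a lower bound on [T]: a small [eps] makes the term without [T] smaller than the
    distance of the ends. *)
Lemma dist_le (B eps : R) : 0 < eps ->
  (forall k, (k <= N)%N -> `|X k| <= B) -> (forall k, (k <= N)%N -> `|Y k| <= B) ->
  `|X N - X 0%N| + `|Y N - Y 0%N| <= 2 * eps * M + T * (eps^-1 + 2 * B).
Proof.
move=> eps0 XB YB.
have dx : `|X N - X 0%N| <= eps * M + ((2 * eps)^-1 + B) * T.
  apply: le_trans (@norm_telescope_le _ X (fun k => tau * (`|px k| + `|Y k|))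
    N _ _ _ _ _) _ => //.
    by move=> k kN; rewrite step_xE normrM gtr0_norm// ler_pM2l// ler_normD.
  apply: (@weighted_sum_le (fun k => `|px k| + `|Y k|)); first exact: ltW.
  by move=> k kN; rewrite addrA lerD// ?abs_px_le// YB// ltnW.
have dy : `|Y N - Y 0%N| <= eps * M + ((2 * eps)^-1 + B) * T.
  apply: le_trans (@norm_telescope_le _ Y (fun k => tau * (`|py k| + `|X k|))
    N _ _ _ _ _) _ => //.
    by move=> k kN; rewrite step_yE normrM gtr0_norm// ler_pM2l// ler_normB.
  apply: (@weighted_sum_le (fun k => `|py k| + `|X k|)); first exact: ltW.
  by move=> k kN; rewrite addrA lerD// ?abs_py_le// XB// ltnW.
have e2 : (2 * eps)^-1 = eps^-1 / 2 by field; rewrite gt_eqF.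
by rewrite e2 in dx dy; lra.
Qed.

Lemma px_sum_le : \sum_(k < N) tau * `|px k| <= D.
Proof.
apply: (@le_trans _ _ (1 * M + (2^-1 + C0) * T)).
  apply: (@weighted_sum_le (fun k => `|px k|)) => //.
  move=> k kN; have := @abs_px_le k 1 ltr01; rewrite mulr1; have := C0_ge0; lra.
by rewrite /D mul1r lerD2l ler_wpM2l ?time_le// addr_ge0// invr_ge0.
Qed.

Lemma py_sum_le : \sum_(k < N) tau * `|py k| <= D.
Proof.
apply: (@le_trans _ _ (1 * M + (2^-1 + C0) * T)).
  apply: (@weighted_sum_le (fun k => `|py k|)) => //.
  move=> k kN; have := @abs_py_le k 1 ltr01; rewrite mulr1; have := C0_ge0; lra.
by rewrite /D mul1r lerD2l ler_wpM2l ?time_le// addr_ge0// invr_ge0.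
Qed.

End APriori.

(** * Continuity of the discrete action and existence of minimisers *)

Section ActionContinuity.
Variables (R : realType) (W : R -> R -> R) (c : R) (N : nat).
Hypothesis W_cont : forall x y : R, W z.1 z.2 @[z --> (x, y)] --> W x y.

Lemma cvg_disc_action (I : Type) (F : set_system I) (FF : Filter F)
    (tau_ : I -> R) (X_ Y_ : I -> nat -> R) (tau : R) (X Y : nat -> R) :
  tau != 0 -> tau_ @ F --> tau ->
  (forall k, X_ ^~ k @ F --> X k) -> (forall k, Y_ ^~ k @ F --> Y k) ->
  (fun i => disc_action W c N (tau_ i) (X_ i) (Y_ i)) @ F -->
    disc_action W c N tau X Y.
Proof.
move=> tau0 c1 cX cY; rewrite /disc_action; elim: N => [|n IH].
  rewrite (_ : (fun _ => _) = fun=> 0); last by apply/funext => i; rewrite big_ord0.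
  by rewrite big_ord0; exact: cvg_cst.
rewrite (_ : (fun _ => _) = fun i =>
    \sum_(k < n) tau_ i * disc_lag W c (tau_ i) (X_ i) (Y_ i) k +
    tau_ i * disc_lag W c (tau_ i) (X_ i) (Y_ i) n); last first.
  by apply/funext => i; rewrite big_ord_recr.
rewrite big_ord_recr/=; apply: cvgD => //; apply: cvgM => //.
have cinv : (fun i => (tau_ i)^-1) @ F --> tau^-1 by exact: cvgV.
have sqr (f : I -> R) (l : R) : f @ F --> l -> (fun i => f i ^+ 2) @ F --> l ^+ 2.
  by move=> fl; rewrite expr2; exact: cvgM.
have px : (fun i => disc_px (tau_ i) (X_ i) (Y_ i) n) @ F --> disc_px tau X Y n.
  by apply: cvgB => //; apply: cvgM => //; apply: cvgB.
have py : (fun i => disc_py (tau_ i) (X_ i) (Y_ i) n) @ F --> disc_py tau X Y n.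
  by apply: cvgD => //; apply: cvgM => //; apply: cvgB.
apply: cvgD; last exact: cvg_cst.
apply: cvgD; last by apply: (@continuous2_cvg I R R R F _ (X_ ^~ n) (Y_ ^~ n) W).
by apply: cvgD; (apply: cvgM; [exact: sqr|exact: cvg_cst]).
Qed.

Local Notation cfg := (R * ({ptws nat -> R} * {ptws nat -> R}))%type.

Lemma disc_action_continuous (z0 : cfg) : z0.1 != 0 ->
  {for z0, continuous (fun z : cfg => disc_action W c N z.1 z.2.1 z.2.2)}.
Proof.
move=> tau0; apply: cvg_disc_action => //.
- exact: cvg_fst.
- move=> k; apply: (@cvg_comp _ _ _ (fun z : cfg => z.2.1)
    (fun X : {ptws nat -> R} => X k) _ (nbhs z0.2.1)).
    by apply: (@cvg_comp _ _ _ snd fst _ (nbhs z0.2)); [exact: cvg_snd|exact: cvg_fst].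
  exact: (@proj_continuous nat (fun=> R) k z0.2.1).
- move=> k; apply: (@cvg_comp _ _ _ (fun z : cfg => z.2.2)
    (fun X : {ptws nat -> R} => X k) _ (nbhs z0.2.2)).
    by apply: (@cvg_comp _ _ _ snd snd _ (nbhs z0.2)); [exact: cvg_snd|exact: cvg_snd].
  exact: (@proj_continuous nat (fun=> R) k z0.2.2).
Qed.

End ActionContinuity.

Section Minimizer.
Variables (R : realType) (W : R -> R -> R) (c C0 M a0 b0 a1 b1 : R).
Hypotheses (W_cont : forall x y : R, W z.1 z.2 @[z --> (x, y)] --> W x y).
Hypotheses (W_ge0 : forall x y : R, 0 <= W x y) (c_gt0 : 0 < c) (C0_ge0 : 0 <= C0).
Hypotheses (xW : forall x y : R, `|x| <= W x y + C0)
  (yW : forall x y : R, `|y| <= W x y + C0).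
Hypotheses (M_gt0 : 0 < M) (neq : (a0 != a1) || (b0 != b1)).

(** The first two terms dominate the starting point, and the rest is the oscillation bound of
    [X_osc] and [Y_osc]. *)
Definition box_size : R := `|a0| + `|b0| + (M + (2^-1 + C0) * (M / c)).
Definition end_dist : R := `|a1 - a0| + `|b1 - b0|.
(** This is [dist_le] at [eps = end_dist / (4 * M)], for which [2 * eps * M] is half of [end_dist],
    solved for the time. *)
Definition min_time : R := end_dist / 2 / (4 * M / end_dist + 2 * box_size).

Lemma end_dist_gt0 : 0 < end_dist.
Proof.
rewrite /end_dist; case/orP: neq => ab.
  by rewrite ltr_wpDr// normr_gt0 subr_eq0 eq_sym.
by rewrite ltr_wpDl// normr_gt0 subr_eq0 eq_sym.
Qed.

Lemma box_size_ge0 : 0 <= box_size.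
Proof.
rewrite !addr_ge0// ?(ltW M_gt0)// mulr_ge0// ?addr_ge0//.
by rewrite divr_ge0// ltW.
Qed.

Lemma min_time_gt0 : 0 < min_time.
Proof.
by rewrite !divr_gt0 ?end_dist_gt0// ltr_wpDr ?mulr_ge0 ?box_size_ge0//
  divr_gt0 ?end_dist_gt0// mulr_gt0.
Qed.

Definition joins (N : nat) (X Y : nat -> R) : Prop :=
  [/\ X 0%N = a0, Y 0%N = b0, X N = a1 & Y N = b1].

Lemma a_priori_bounds (N : nat) (tau : R) (X Y : nat -> R) : 0 < tau ->
  joins N X Y -> disc_action W c N tau X Y <= M ->
  [/\ min_time <= N%:R * tau <= M / c,
    (forall k, (k <= N)%N -> `|X k| <= box_size) &
    (forall k, (k <= N)%N -> `|Y k| <= box_size)].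
Proof.
move=> tau0 [X0 Y0 XN YN] SM.
have XB k : (k <= N)%N -> `|X k| <= box_size.
  move=> kN; have := @X_osc R W c C0 W_ge0 c_gt0 C0_ge0 yW N tau M X Y tau0 SM 0 k (leq0n _) kN.
  rewrite X0 /box_size => h; have := ler_normD a0 (X k - a0).
  by rewrite addrC subrK; have := normr_ge0 b0; lra.
have YB k : (k <= N)%N -> `|Y k| <= box_size.
  move=> kN; have := @Y_osc R W c C0 W_ge0 c_gt0 C0_ge0 xW N tau M X Y tau0 SM 0 k (leq0n _) kN.
  rewrite Y0 /box_size => h; have := ler_normD b0 (Y k - b0).
  by rewrite addrC subrK; have := normr_ge0 a0; lra.
split => //; rewrite (time_le W_ge0 c_gt0 tau0 SM) andbT.
have d0 := end_dist_gt0; have B0 := box_size_ge0.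
have eps0 : 0 < end_dist / (4 * M) by rewrite divr_gt0// mulr_gt0.
have := dist_le W_ge0 c_gt0 tau0 SM eps0 XB YB.
rewrite X0 Y0 XN YN -/end_dist invf_div => h.
have e1 : 2 * (end_dist / (4 * M)) * M = end_dist / 2 by field; rewrite gt_eqF.
rewrite /min_time ler_pdivrMr; last first.
  by rewrite ltr_wpDr ?mulr_ge0// divr_gt0// mulr_gt0.
by rewrite e1 in h; lra.
Qed.

(* The constraints are strictly weaker than the bounds of [a_priori_bounds], so
   that minimisers are interior. *)
Definition in_domain (N : nat) (tau : R) (X Y : nat -> R) : Prop :=
  [/\ min_time / 2 / N%:R <= tau <= (M / c + 1) / N%:R, joins N X Y,
    (forall k, `|X k| <= box_size + `|a1| + `|b1| + 1) &
    (forall k, `|Y k| <= box_size + `|a1| + `|b1| + 1)].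

(** Configurations are infinite sequences with the pointwise topology, confined to a product of
    segments, which is compact by Tychonoff. The lower bound on [tau] keeps the action continuous
    there. *)
Lemma exists_minimizer (N : nat) (tau' : R) (X' Y' : nat -> R) : (0 < N)%N ->
  in_domain N tau' X' Y' -> 
  exists tau X Y, in_domain N tau X Y /\
    forall tau' X' Y', in_domain N tau' X' Y' ->
      disc_action W c N tau X Y <= disc_action W c N tau' X' Y'.
Proof.
move=> N0 dom'.
have N0' : 0 < N%:R :> R by rewrite ltr0n.
pose B : R := box_size + `|a1| + `|b1| + 1.
(* Implications pin the two ends within one description valid for every index; each is a closed
   condition. *)
pose A (a b : R) (k : nat) : set R :=
  `[-B, B] `&` [set x | (k = 0%N -> x = a) /\ (k = N -> x = b)].
have Acpt a b k : compact (A a b k).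
  apply: (@subclosed_compact _ _ `[-B, B]); [|exact: segment_compact|by move=> ? []].
  have E (j : nat) (e : R) : closed [set x | k = j -> x = e].
    case: (pselect (k = j)) => kj.
      rewrite (_ : [set x | _] = [set e]); first exact: closed_eq.
      by apply/seteqP; split => [x /(_ kj)|x ->].
    rewrite (_ : [set x | _] = setT); first exact: closedT.
    by apply/seteqP; split => x // _ /kj.
  by apply: closedI; [exact: itv_closed|exact: closedI (E _ _) (E _ _)].
pose K : set (R * ({ptws nat -> R} * {ptws nat -> R})) :=
  `[min_time / 2 / N%:R, (M / c + 1) / N%:R] `*`
  ([set f | forall k, A a0 a1 k (f k)] `*` [set f | forall k, A b0 b1 k (f k)]).
have Kcpt : compact K.
  apply: compact_setX; first exact: segment_compact.
  by apply: compact_setX; apply: (@tychonoff nat (fun=> R)).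
have domK tau X Y : in_domain N tau X Y <-> K (tau, (X, Y)).
  split=> [[t [X0 Y0 XN YN] XB YB]|[/= t [/= XA YA]]].
    split => /=; first by rewrite in_itv.
    split => /= k; (split; first by rewrite /= in_itv/= -ler_norml).
      by split => ->.
    by split => ->.
  split; first by rewrite in_itv/= in t.
  - by split; [case: (XA 0%N) => _ []|case: (YA 0%N) => _ []|
      case: (XA N) => _ []|case: (YA N) => _ []] => h1 h2; (exact: h1 || exact: h2).
  - by move=> k; have [+ _] := XA k; rewrite /= in_itv/= ler_norml.
  - by move=> k; have [+ _] := YA k; rewrite /= in_itv/= ler_norml.
have [] := @compact_EVT_min _ R (fun z : R * ({ptws nat -> R} * {ptws nat -> R}) =>
  disc_action W c N z.1 z.2.1 z.2.2) K _ Kcpt.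
- by exists (tau', (X', Y')); apply/domK.
- apply: continuous_in_subspaceT => z; rewrite inE => -[/= + _].
  rewrite in_itv/= => /andP[+ _] => ht; apply: disc_action_continuous => //.
  rewrite gt_eqF// (lt_le_trans _ ht)//.
  by do 2 apply: divr_gt0 => //; exact: min_time_gt0.
move=> [tau [X Y]]; rewrite inE => /domK dom minz; exists tau, X, Y; split => //.
by move=> t' X1 Y1 /domK d'; apply: (minz (t', (X1, Y1))); rewrite inE.
Qed.

End Minimizer.

(** * Euler-Lagrange equations and mean energy of the minimisers *)

Section Critical.
Variables (R : realType) (W Wx Wy : R -> R -> R) (c C0 M a0 b0 a1 b1 : R).
Hypotheses (W_cont : forall x y : R, W z.1 z.2 @[z --> (x, y)] --> W x y).
Hypotheses (Wx_der : forall x y : R, is_derive x 1 (W ^~ y) (Wx x y)).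
Hypotheses (Wy_der : forall x y : R, is_derive y 1 (W x) (Wy x y)).
Hypotheses (W_ge0 : forall x y : R, 0 <= W x y) (c_gt0 : 0 < c) (C0_ge0 : 0 <= C0).
Hypotheses (xW : forall x y : R, `|x| <= W x y + C0)
  (yW : forall x y : R, `|y| <= W x y + C0).
Hypotheses (M_gt0 : 0 < M) (neq : (a0 != a1) || (b0 != b1)).

Local Notation dom := (in_domain c C0 M a0 b0 a1 b1).
Local Notation box := (box_size c C0 M a0 b0).

Section Minimum.
Variables (N : nat) (tau : R) (X Y : nat -> R).
Hypotheses (N_gt0 : (0 < N)%N) (dXY : dom N tau X Y).
Hypothesis minXY : forall tau' X' Y', dom N tau' X' Y' ->
  disc_action W c N tau X Y <= disc_action W c N tau' X' Y'.
Hypothesis SM : disc_action W c N tau X Y <= M.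

Local Notation px := (disc_px tau X Y).
Local Notation py := (disc_py tau X Y).

Lemma minimizer_tau_gt0 : 0 < tau.
Proof.
have [/andP[t _] _ _ _] := dXY; rewrite (lt_le_trans _ t)//.
apply: divr_gt0; last by rewrite ltr0n.
by apply: divr_gt0 => //; exact: min_time_gt0.
Qed.
Let tau0 := minimizer_tau_gt0.

Let aprioriXY := a_priori_bounds W_ge0 c_gt0 C0_ge0 xW yW M_gt0 neq tau0
  (let: And4 _ j _ _ := dXY in j) SM.

Local Notation B := (box + `|a1| + `|b1| + 1).

Lemma interior_itv (x : R) : `|x| <= box -> x \in `]- B, B[%R.
Proof.
rewrite in_itv/= => h; rewrite -ltr_norml (le_lt_trans h)//.
by have := normr_ge0 a1; have := normr_ge0 b1; lra.
Qed.

Lemma itv_norm (x : R) : x \in `]- B, B[%R -> `|x| <= B.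
Proof. by rewrite in_itv/= -ltr_norml => /ltW. Qed.

(** By the a priori bounds the minimiser is interior, so the derivative of the action in the single
    coordinate [X j.+1] vanishes; the equation is this derivative regrouped. *)
Lemma euler_lagrange_x (j : nat) : (j.+1 < N)%N ->
  px j.+1 - px j = tau * (py j.+1 + Wx (X j.+1) (Y j.+1)).
Proof.
move=> jN; have tau_neq0 : tau != 0 by rewrite gt_eqF.
have [_ XB _] := aprioriXY.
pose X' s k := if k == j.+1 then s else X k.
pose g (s : R) := tau * (((s - X j) / tau - Y j) ^+ 2 / 2 +
  ((Y j.+1 - Y j) / tau + X j) ^+ 2 / 2 + W (X j) (Y j) + c) +
  tau * (((X j.+2 - s) / tau - Y j.+1) ^+ 2 / 2 +
  ((Y j.+2 - Y j.+1) / tau + s) ^+ 2 / 2 + W s (Y j.+1) + c).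
have gder (s : R) : is_derive s 1 g (((s - X j) / tau - Y j)
    + tau * (- (((X j.+2 - s) / tau - Y j.+1) / tau) +
             ((Y j.+2 - Y j.+1) / tau + s) + Wx s (Y j.+1))).
  have W' := Wx_der s (Y j.+1).
  by apply: is_derive_eq; rewrite /GRing.scale/=; field.
have gmin (s : R) : s \in `]- B, B[%R -> g (X j.+1) <= g s.
  move=> sB; have : disc_action W c N tau X Y <= disc_action W c N tau (X' s) Y.
    apply: minXY; have [t [X0 Y0 XN YN] XB' YB'] := dXY; split => //.
      (* The index [j.+1] is neither [0] nor [N], so the moved polygon has the same ends. *)
      by split => //; rewrite /X' (gtn_eqF jN).
    by move=> k; rewrite /X'; case: eqP => // _; exact: itv_norm.
  rewrite -subr_ge0 (@sum_local2 _ (fun k => tau * disc_lag W c tau (X' s) Y k)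
    (fun k => tau * disc_lag W c tau X Y k) N j)//; last first.
    move=> k kN kj kj1; rewrite /disc_lag/disc_px/disc_py/X' (negbTE kj1).
    by rewrite eqSS (negbTE kj).
  rewrite /disc_lag/disc_px/disc_py/X' eqxx.
  by rewrite (ltn_eqF (ltnSn j)) (gtn_eqF (ltnSn j.+1)) subr_ge0.
have [_ g0] : is_derive (X j.+1) 1 g 0.
  apply: (@derive1_at_min _ _ (- B) B _ _ _ _ gmin).
  - by have := box_size_ge0 a0 b0 c_gt0 C0_ge0 M_gt0; have := normr_ge0 a1;
      have := normr_ge0 b1; lra.
  - by move=> s _; have [] := gder s.
  - by apply: interior_itv; apply: XB; exact: ltnW.
have [_] := gder (X j.+1); rewrite g0 => e.
apply/eqP; rewrite -subr_eq0; apply/eqP; rewrite -[RHS]oppr0 e /disc_px /disc_py.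
by field.
Qed.

Lemma euler_lagrange_y (j : nat) : (j.+1 < N)%N ->
  py j.+1 - py j = tau * (- px j.+1 + Wy (X j.+1) (Y j.+1)).
Proof.
move=> jN; have tau_neq0 : tau != 0 by rewrite gt_eqF.
have [_ _ YB] := aprioriXY.
pose Y' s k := if k == j.+1 then s else Y k.
pose g (s : R) := tau * (((X j.+1 - X j) / tau - Y j) ^+ 2 / 2 +
  ((s - Y j) / tau + X j) ^+ 2 / 2 + W (X j) (Y j) + c) +
  tau * (((X j.+2 - X j.+1) / tau - s) ^+ 2 / 2 +
  ((Y j.+2 - s) / tau + X j.+1) ^+ 2 / 2 + W (X j.+1) s + c).
have gder (s : R) : is_derive s 1 g (((s - Y j) / tau + X j)
    + tau * (- ((X j.+2 - X j.+1) / tau - s) -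
             ((Y j.+2 - s) / tau + X j.+1) / tau + Wy (X j.+1) s)).
  have W' := Wy_der (X j.+1) s.
  by apply: is_derive_eq; rewrite /GRing.scale/=; field.
have gmin (s : R) : s \in `]- B, B[%R -> g (Y j.+1) <= g s.
  move=> sB; have : disc_action W c N tau X Y <= disc_action W c N tau X (Y' s).
    apply: minXY; have [t [X0 Y0 XN YN] XB' YB'] := dXY; split => //.
      by split => //; rewrite /Y' (gtn_eqF jN).
    by move=> k; rewrite /Y'; case: eqP => // _; exact: itv_norm.
  rewrite -subr_ge0 (@sum_local2 _ (fun k => tau * disc_lag W c tau X (Y' s) k)
    (fun k => tau * disc_lag W c tau X Y k) N j)//; last first.
    move=> k kN kj kj1; rewrite /disc_lag/disc_px/disc_py/Y' (negbTE kj1).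
    by rewrite eqSS (negbTE kj).
  rewrite /disc_lag/disc_px/disc_py/Y' eqxx.
  by rewrite (ltn_eqF (ltnSn j)) (gtn_eqF (ltnSn j.+1)) subr_ge0.
have [_ g0] : is_derive (Y j.+1) 1 g 0.
  apply: (@derive1_at_min _ _ (- B) B _ _ _ _ gmin).
  - by have := box_size_ge0 a0 b0 c_gt0 C0_ge0 M_gt0; have := normr_ge0 a1;
      have := normr_ge0 b1; lra.
  - by move=> s _; have [] := gder s.
  - by apply: interior_itv; apply: YB; exact: ltnW.
have [_] := gder (Y j.+1); rewrite g0 => e.
apply/eqP; rewrite -subr_eq0; apply/eqP; rewrite -[RHS]oppr0 e /disc_px /disc_py.
by field.
Qed.

(* Stationarity with respect to the time step. *)
Lemma mean_energy :
  \sum_(k < N) (px k ^+ 2 / 2 + py k ^+ 2 / 2 + px k * Y k - py k * X k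
    - W (X k) (Y k)) = N%:R * c.
Proof.
have tau_neq0 : tau != 0 by rewrite gt_eqF.
have N0 : 0 < N%:R :> R by rewrite ltr0n.
(* With the vertices fixed, velocities scale as the inverse of the step [s], and the action becomes
   [al / s + be * s + ga]. *)
pose al := \sum_(k < N) ((X k.+1 - X k) ^+ 2 + (Y k.+1 - Y k) ^+ 2) / 2.
pose be := \sum_(k < N) ((X k ^+ 2 + Y k ^+ 2) / 2 + W (X k) (Y k) + c).
pose ga := \sum_(k < N) ((Y k.+1 - Y k) * X k - (X k.+1 - X k) * Y k).
have SE s : s != 0 -> disc_action W c N s X Y = al * s^-1 + s * be + ga.
  move=> s0; rewrite /disc_action mulr_sumr mulr_suml -!big_split/=.
  by apply: eq_bigr => k _; rewrite /disc_lag/disc_px/disc_py; field.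
have [/andP[t1 t2] _ _] := aprioriXY.
pose lo := min_time c C0 M a0 b0 a1 b1 / 2 / N%:R.
pose hi := (M / c + 1) / N%:R.
have mt := min_time_gt0 c_gt0 C0_ge0 M_gt0 neq.
have lo0 : 0 < lo by apply: divr_gt0 => //; apply: divr_gt0.
pose g s := al * s^-1 + s * be + ga.
have gder (s : R) : s \in `]lo, hi[%R -> is_derive s 1 g (- al * s ^- 2 + be).
  rewrite in_itv/= => /andP[los _]; have s0 : s != 0 by rewrite gt_eqF// (lt_trans lo0).
  have iV : is_derive s 1 (fun s : R => s^-1) (- s ^- 2).
    apply: is_derive_eq; first by apply: is_deriveV; exact: s0.
    by rewrite [LHS]mulr1.
  by apply: is_derive_eq; rewrite /GRing.scale/=; ring.
have [] : is_derive tau 1 g 0.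
  apply: (@derive1_at_min _ _ lo hi).
  - by rewrite /lo /hi ler_pM2r ?invr_gt0//; have := ltW mt; lra.
  - by move=> s /gder [].
  - rewrite in_itv/=; apply/andP; split.
      by rewrite /lo ltr_pdivrMr// mulrC; lra.
    by rewrite /hi ltr_pdivlMr// mulrC; lra.
  - move=> s slh; have := slh; rewrite in_itv/= => /andP[s1 s2].
    have s0 : s != 0 by rewrite gt_eqF// (lt_trans lo0).
    rewrite /g -SE// -SE//; apply: minXY.
    by have [t j XB' YB'] := dXY; split => //; rewrite !ltW.
have tlh : tau \in `]lo, hi[%R.
  rewrite in_itv/=; apply/andP; split.
    by rewrite /lo ltr_pdivrMr// mulrC; lra.
  by rewrite /hi ltr_pdivlMr// mulrC; lra.
have [_ ->] := gder _ tlh; move=> _ e.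
(* Stationarity is [al * tau ^- 2 = be]. In terms of the velocity the energy is
   [|q'|^2/2 - |q|^2/2 - W], so this says that the energies of the steps add up to [N * c]. *)
have -> : N%:R * c = al * tau ^- 2 - (be - N%:R * c).
  by rewrite -[LHS]add0r -[in LHS]oppr0 -e; ring.
rewrite -sum_const_ord /al /be mulr_suml -!sumrB.
by apply: eq_bigr => k _; rewrite /disc_px/disc_py; field.
Qed.

End Minimum.

Variable m : R.
Hypothesis line_le : forall s : R, 0 <= s <= 1 ->
  W (a0 + s * (a1 - a0)) (b0 + s * (b1 - b0)) <= m.
Hypothesis M_ge : (`|a1 - a0| + (`|b0| + `|b1|)) ^+ 2 / 2 +
  (`|b1 - b0| + (`|a0| + `|a1|)) ^+ 2 / 2 + m + c <= M.

Lemma norm_convex_le (s x y : R) : 0 <= s <= 1 ->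
  `|x + s * (y - x)| <= `|x| + `|y|.
Proof.
move=> /andP[s0 s1]; rewrite (_ : _ + _ = (1 - s) * x + s * y); last by ring.
rewrite (le_trans (ler_normD _ _))// !normrM (ger0_norm s0) ger0_norm ?subr_ge0//.
by rewrite lerD// ler_piMl//; lra.
Qed.

(** The straight segment, run in unit time, is a competitor whose action is at most [M] for every
    [N]; this is why the later bounds are uniform in [N]. *)
Lemma exists_discrete_orbit (N : nat) : (0 < N)%N ->
  exists tau X Y, [/\ 0 < tau, joins a0 b0 a1 b1 N X Y,
    disc_action W c N tau X Y <= M,
    (forall j, (j.+1 < N)%N ->
      disc_px tau X Y j.+1 - disc_px tau X Y j =
        tau * (disc_py tau X Y j.+1 + Wx (X j.+1) (Y j.+1)) /\
      disc_py tau X Y j.+1 - disc_py tau X Y j =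
        tau * (- disc_px tau X Y j.+1 + Wy (X j.+1) (Y j.+1))) &
    \sum_(k < N) (disc_px tau X Y k ^+ 2 / 2 + disc_py tau X Y k ^+ 2 / 2
      + disc_px tau X Y k * Y k - disc_py tau X Y k * X k - W (X k) (Y k))
      = N%:R * c].
Proof.
move=> N0; have N0' : 0 < N%:R :> R by rewrite ltr0n.
have Nneq : N%:R != 0 :> R by rewrite gt_eqF.
(* The index is cut off at [N] because [in_domain] constrains the vertices beyond the end as
   well. *)
pose s k : R := (minn k N)%:R / N%:R.
have s01 k : 0 <= s k <= 1.
  by rewrite divr_ge0 ?ler0n// ler_pdivrMr// mul1r ler_nat geq_minr.
pose X' k := a0 + s k * (a1 - a0); pose Y' k := b0 + s k * (b1 - b0).
have S0 : s 0%N = 0 by rewrite /s min0n mul0r.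
have S1 : s N = 1 by rewrite /s minnn divff.
have jl : joins a0 b0 a1 b1 N X' Y'.
  by split; rewrite /X' /Y' ?S0 ?S1 ?mul0r ?mul1r ?addr0// addrC subrK.
have ds k : (k < N)%N -> s k.+1 - s k = N%:R^-1.
  move=> kN; rewrite /s !(minn_idPl _)// ?(ltnW kN)// -mulrBl -natrB// subSnn mul1r.
  by [].
have tau0 : 0 < N%:R^-1 :> R by rewrite invr_gt0.
have lineM : disc_action W c N N%:R^-1 X' Y' <= M.
  apply: (@le_trans _ _ (\sum_(k < N) N%:R^-1 * M)); last first.
    by rewrite sum_const_ord mulrA mulfV// mul1r.
  apply: ler_sum => k _; rewrite ler_pM2l//; apply: le_trans M_ge.
  rewrite /disc_lag/disc_px/disc_py.
  have -> : (X' k.+1 - X' k) / N%:R^-1 = a1 - a0.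
    have -> : X' k.+1 - X' k = (s k.+1 - s k) * (a1 - a0) by rewrite /X'; ring.
    by rewrite ds//; field.
  have -> : (Y' k.+1 - Y' k) / N%:R^-1 = b1 - b0.
    have -> : Y' k.+1 - Y' k = (s k.+1 - s k) * (b1 - b0) by rewrite /Y'; ring.
    by rewrite ds//; field.
  rewrite lerD2r; apply: lerD; last exact: line_le.
  apply: lerD; rewrite ler_pM2r ?invr_gt0// -[leLHS]real_normK ?num_real//
    ler_sqr ?nnegrE ?addr_ge0//.
    by rewrite (le_trans (ler_normB _ _))// lerD2l norm_convex_le.
  by rewrite (le_trans (ler_normD _ _))// lerD2l norm_convex_le.
have Dge0 : 0 <= M + (2^-1 + C0) * (M / c).
  rewrite addr_ge0 ?(ltW M_gt0)// mulr_ge0 ?addr_ge0//.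
  by rewrite divr_ge0// ltW.
have dl : dom N N%:R^-1 X' Y'.
  have mt := min_time_gt0 c_gt0 C0_ge0 M_gt0 neq.
  have [t _ _] := a_priori_bounds W_ge0 c_gt0 C0_ge0 xW yW M_gt0 neq tau0 jl lineM.
  rewrite mulfV// in t; case/andP: t => t1 t2.
  split => //.
  - by rewrite -[X in _ <= X <= _]mul1r !ler_pM2r//; apply/andP; split; lra.
  - move=> k; rewrite (le_trans (norm_convex_le _ _ (s01 k)))// /box_size.
    by have := normr_ge0 b0; have := normr_ge0 b1; lra.
  - move=> k; rewrite (le_trans (norm_convex_le _ _ (s01 k)))// /box_size.
    by have := normr_ge0 a0; have := normr_ge0 a1; lra.
have [tau [X [Y [dXY minXY]]]] := exists_minimizer W_cont c_gt0 C0_ge0 M_gt0 neq N0 dl.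
(* Comparison with the segment. The bounds that put the minimiser in the interior of the domain
   start from this. *)
have SM : disc_action W c N tau X Y <= M by apply: le_trans lineM; exact: minXY.
exists tau, X, Y; split => //.
- exact: minimizer_tau_gt0 N0 dXY.
- by case: dXY.
- by move=> j jN; split; [exact: (euler_lagrange_x N0 dXY)|exact: (euler_lagrange_y N0 dXY)].
- exact: (mean_energy N0 dXY).
Qed.

End Critical.

(** * Differential calculus *)

Section Calculus.
Variable R : realType.

Lemma is_derive_lin (f : R -> R) (t phi : R) :
  (forall eps, 0 < eps -> exists2 del, 0 < del &
     forall s, `|s - t| < del -> `|f s - f t - (s - t) * phi| <= eps * `|s - t|) ->
  is_derive t 1 f phi.
Proof.
move=> H.
have h : (fun h => h^-1 *: (f (h *: 1 + t) - f t)) @ 0^' --> phi.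
  apply/cvgrPdist_le => eps eps0; have [del del0 Hd] := H _ eps0.
  near=> h.
  have h0 : h != 0 by near: h; exact: nbhs_dnbhs_neq.
  have hd : `|h| < del.
    near: h; apply: dnbhs0_lt => //.
  rewrite [h *: 1]mulr1; have := Hd (h + t); rewrite addrK => /(_ hd) H1.
  rewrite distrC /GRing.scale/= -(@ler_pM2r _ `|h|) ?normr_gt0//.
  rewrite -normrM (_ : _ * h = f (h + t) - f t - h * phi)//.
  by field.
apply: DeriveDef; first by apply/cvg_ex; exists phi.
exact: (@cvg_lim R).
Unshelve. all: by end_near. Qed.

Lemma lin_is_derive (f : R -> R) (t phi : R) : is_derive t 1 f phi ->
  forall eps, 0 < eps -> exists2 del, 0 < del &
     forall s, `|s - t| < del -> `|f s - f t - (s - t) * phi| <= eps * `|s - t|.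
Proof.
move=> [df dv] eps eps0.
have h : (fun h => h^-1 *: (f (h *: 1 + t) - f t)) @ 0^' --> phi.
  by rewrite -dv; exact: df.
move/cvgrPdist_le : h => /(_ _ eps0)[del del0 Hd]; exists del => // s sd.
have [->|st] := eqVneq s t; first by rewrite !subrr mul0r subr0 normr0 mulr0.
have st0 : s - t != 0 by rewrite subr_eq0.
have := Hd (s - t); rewrite /= sub0r normrN => /(_ sd st0).
rewrite [(s - t) *: 1]mulr1 subrK /GRing.scale/= distrC.
rewrite -(@ler_pM2r _ `|s - t|) ?normr_gt0// -normrM.
by congr (`| _ | <= _); field.
Qed.

Lemma continuous2_lin (F : R -> R -> R) (a b : R) :
  F z.1 z.2 @[z --> (a, b)] --> F a b ->
  forall eps, 0 < eps -> exists2 del, 0 < del &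
    forall x y, `|x - a| < del -> `|y - b| < del -> `|F x y - F a b| <= eps.
Proof.
move=> /cvgrPdist_le H eps /H [[A B] /= [[d1 d10 A1] [d2 d20 B2]] AB].
exists (Num.min d1 d2); first by rewrite lt_min d10.
move=> x y; rewrite !lt_min => /andP[xa _] /andP[_ yb]; rewrite distrC.
apply: (AB (x, y)); split => /=.
  by apply: A1; rewrite /= distrC.
by apply: B2; rewrite /= distrC.
Qed.

Lemma MVT_abs (f f' : R -> R) (a b K : R) :
  (forall x : R, is_derive x 1 f (f' x)) ->
  (forall x, Num.min a b <= x <= Num.max a b -> `|f' x| <= K) ->
  `|f b - f a| <= K * `|b - a|.
Proof.
move=> fd; wlog ab : a b / a < b => [H fK|fK].
  have [ab|ba|->] := ltgtP a b; first exact: H.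
    by rewrite distrC [`|b - a|]distrC; apply: H => // x; rewrite minC maxC; exact: fK.
  by rewrite !subrr normr0 mulr0.
have fc : {within `[a, b], continuous f}.
  apply: continuous_subspaceT => x; apply: differentiable_continuous.
  by apply/derivable1_diffP; have [] := fd x.
have [r rab ->] := MVT ab (fun x _ => fd x) fc.
rewrite normrM ler_pM2r ?normr_gt0 ?subr_eq0 ?gt_eqF//; apply: fK.
rewrite (min_l (ltW ab)) (max_r (ltW ab)).
by move: rab; rewrite in_itv/= => /andP[/ltW -> /ltW ->].
Qed.

(** The increment is split at [(x t, y s)], and the mean value theorem handles each half in one
    variable. Continuity of the partial derivatives at the point then controls the error. *)
Lemma is_derive_chain2 (F Fx Fy : R -> R -> R) (x y : R -> R) (t dx dy : R) :
  (forall a b : R, is_derive a 1 (F ^~ b) (Fx a b)) ->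
  (forall a b : R, is_derive b 1 (F a) (Fy a b)) ->
  Fx z.1 z.2 @[z --> (x t, y t)] --> Fx (x t) (y t) ->
  Fy z.1 z.2 @[z --> (x t, y t)] --> Fy (x t) (y t) ->
  is_derive t 1 x dx -> is_derive t 1 y dy ->
  is_derive t 1 (fun s => F (x s) (y s)) (Fx (x t) (y t) * dx + Fy (x t) (y t) * dy).
Proof.
move=> Fxd Fyd cFx cFy xd yd; apply: is_derive_lin => eps eps0.
set A := Fx _ _; set B := Fy _ _.
(* [K] adds up the coefficients of all error terms, so that the total error is [e * K] times
   [|s - t|]. *)
pose K := `|dx| + `|dy| + 2 + `|A| + `|B|.
have K0 : 0 < K by rewrite /K; have := normr_ge0 dx; have := normr_ge0 dy;
  have := normr_ge0 A; have := normr_ge0 B; lra.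
pose e := Num.min 1 (eps / K).
have e0 : 0 < e by rewrite lt_min ltr01 divr_gt0.
have e1 : e <= 1 by rewrite ge_min lexx.
have eK : e * K <= eps by rewrite -ler_pdivlMr// ge_min lexx orbT.
have [d1 d10 H1] := lin_is_derive xd e0.
have [d2 d20 H2] := lin_is_derive yd e0.
have [d3 d30 H3] := continuous2_lin cFx e0.
have [d4 d40 H4] := continuous2_lin cFy e0.
pose d5 := Num.min d3 d4.
have d50 : 0 < d5 by rewrite lt_min d30.
exists (Num.min (Num.min d1 d2) (d5 / K)); first by rewrite !lt_min d10 d20 divr_gt0.
move=> s; rewrite !lt_min => /andP[/andP[s1 s2] s5].
have {}H1 := H1 _ s1; have {}H2 := H2 _ s2.
set u := s - t in s1 s2 s5 H1 H2 *.
have u0 : 0 <= `|u| by [].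
have Hx : `|x s - x t| <= (`|dx| + 1) * `|u|.
  have := ler_normD (x s - x t - u * dx) (u * dx); rewrite subrK normrM.
  by move=> h; apply: (le_trans h); nra.
have Hy : `|y s - y t| <= (`|dy| + 1) * `|u|.
  have := ler_normD (y s - y t - u * dy) (u * dy); rewrite subrK normrM.
  by move=> h; apply: (le_trans h); nra.
have uK : `|u| * K < d5 by rewrite -ltr_pdivlMr.
have xs5 : `|x s - x t| < d5.
  apply: (le_lt_trans Hx); apply: le_lt_trans uK; rewrite mulrC ler_wpM2l// /K.
  by have := normr_ge0 dy; have := normr_ge0 A; have := normr_ge0 B; lra.
have ys5 : `|y s - y t| < d5.
  apply: (le_lt_trans Hy); apply: le_lt_trans uK; rewrite mulrC ler_wpM2l// /K.
  by have := normr_ge0 dx; have := normr_ge0 A; have := normr_ge0 B; lra.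
have btw (a b r : R) : Num.min a b <= r <= Num.max a b -> `|r - a| <= `|b - a|.
  have [ab|ba] := leP a b => /andP[h1 h2].
    by rewrite !ger0_norm ?subr_ge0// lerD2r.
  by rewrite distrC [`|b - a|]distrC !ger0_norm ?subr_ge0 ?(ltW ba)// lerD2l lerN2.
(* Subtracting the linear part leaves a function whose derivative [Fx - A] is at most [e] in
   absolute value near the point. *)
have I1 : `|(F (x s) (y s) - A * x s) - (F (x t) (y s) - A * x t)| <= e * `|x s - x t|.
  apply: (@MVT_abs (fun r => F r (y s) - A * r) (fun r => Fx r (y s) - A)) => [r|r /btw h].
    have := Fxd r (y s) => ?; apply: is_derive_eq; rewrite /GRing.scale/=; ring.
  apply: H3; first by apply: (le_lt_trans h); move: xs5; rewrite lt_min => /andP[].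
  by move: ys5; rewrite lt_min => /andP[].
have I2 : `|(F (x t) (y s) - B * y s) - (F (x t) (y t) - B * y t)| <= e * `|y s - y t|.
  apply: (@MVT_abs (fun r => F (x t) r - B * r) (fun r => Fy (x t) r - B)) => [r|r /btw h].
    have := Fyd (x t) r => ?; apply: is_derive_eq; rewrite /GRing.scale/=; ring.
  apply: H4; first by rewrite subrr normr0.
  by apply: (le_lt_trans h); move: ys5; rewrite lt_min => /andP[].
rewrite (_ : _ - _ = ((F (x s) (y s) - A * x s) - (F (x t) (y s) - A * x t))
  + ((F (x t) (y s) - B * y s) - (F (x t) (y t) - B * y t))
  + (A * (x s - x t - u * dx) + B * (y s - y t - u * dy))); last by ring.
apply: le_trans (ler_wpM2r u0 eK).
rewrite (le_trans (ler_normD _ _))//.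
apply: (@le_trans _ _ (e * ((`|dx| + 1) * `|u|) + e * ((`|dy| + 1) * `|u|)
   + (`|A| * (e * `|u|) + `|B| * (e * `|u|)))); last first.
  by rewrite le_eqVlt; apply/orP; left; apply/eqP; rewrite /K; ring.
apply: lerD.
  rewrite (le_trans (ler_normD _ _))//; apply: lerD.
    by apply: (le_trans I1); rewrite ler_pM2l.
  by apply: (le_trans I2); rewrite ler_pM2l.
rewrite (le_trans (ler_normD _ _))// !normrM.
by apply: lerD; apply: ler_wpM2l.
Qed.

(** Difference quotients lie between two values of [G] taken in the interval, and continuity at [t]
    squeezes them to [G t]. There are two points [r] and [r'] because the passage to the limit
    yields the two inequalities at unrelated points. *)
Lemma is_derive_mean (f G : R -> R) (a b t : R) : a < t < b ->
  (forall u v, a <= u -> u < v -> v <= b -> exists r r', [/\ u <= r <= v, u <= r' <= v &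
     G r * (v - u) <= f v - f u <= G r' * (v - u)]) ->
  continuous_at t G -> is_derive t 1 f (G t).
Proof.
move=> /andP[at_ tb] H /cvgrPdist_le cG; apply: is_derive_lin => eps eps0.
have [d0 /= d00 Hd] := cG _ eps0.
exists (Num.min d0 (Num.min (t - a) (b - t))).
  by rewrite !lt_min d00 !subr_gt0 at_.
move=> s; rewrite !lt_min => /and3P[sd sa sb].
have Gd r : `|r - t| < d0 -> G t - eps <= G r <= G t + eps.
  by move=> rd; rewrite -ler_distlC; apply: Hd; rewrite /= distrC.
have [st|ts|->] := ltgtP s t; last by rewrite !subrr mul0r subrr normr0 mulr0.
- have a_s : a <= s by have := ltW sa; rewrite ler0_norm ?subr_le0 ?(ltW st)//; lra.
  have [r [r' [/andP[r1 r2] /andP[r3 r4] /andP[h1 h2]]]] := H s t a_s st (ltW tb).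
  rewrite ltr0_norm ?subr_lt0// in sd *.
  have [|g1 g2] := andP (Gd r _); first by rewrite ler0_norm ?subr_le0//; lra.
  have [|g3 g4] := andP (Gd r' _); first by rewrite ler0_norm ?subr_le0//; lra.
  by rewrite ler_norml; apply/andP; split; nra.
- have s_b : s <= b by have := ltW sb; rewrite ger0_norm ?subr_ge0 ?(ltW ts)//; lra.
  have [r [r' [/andP[r1 r2] /andP[r3 r4] /andP[h1 h2]]]] := H t s (ltW at_) ts s_b.
  rewrite gtr0_norm ?subr_gt0// in sd *.
  have [|g1 g2] := andP (Gd r _); first by rewrite ger0_norm ?subr_ge0//; lra.
  have [|g3 g4] := andP (Gd r' _); first by rewrite ger0_norm ?subr_ge0//; lra.
  by rewrite ler_norml; apply/andP; split; nra.
Qed.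

End Calculus.

(** * Limits of grid functions along an ultrafilter *)

Section UltraLimit.
Variables (R : realType) (U : set_system nat).
Context {UU : UltraFilter U}.
Hypothesis U_oo : forall n0 : nat, U [set n | (n0 <= n)%N].

(** Limits along an ultrafilter replace the extraction of subsequences: all bounded sequences
    converge along the same [U], including the nodes of indices selected later. *)
Lemma ultra_cvg (u : nat -> R) (B : R) : (forall n, `|u n| <= B) ->
  exists2 l : R, `|l| <= B & u @ U --> l.
Proof.
move=> uB; have [|p [/= pB clp]] := @segment_compact R (- B) B (u @ U) _.
  by apply: (@filterE _ U) => n; rewrite /= in_itv/= -ler_norml; exact: uB.
exists p; first by move: pB; rewrite in_itv/= -ler_norml.
move=> A Ap; have [//|UnA] := in_ultra_setVsetC (u @^-1` A) UU.
by have [x [/= nAx Ax]] := clp (~` A) A UnA Ap.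
Qed.

Lemma ultra_inv : (fun n : nat => n.+1%:R^-1 : R) @ U --> (0 : R).
Proof.
have : (fun n : nat => n.+1%:R^-1 : R) @ \oo --> (0 : R) by exact: cvg_harmonic.
apply: cvg_trans; apply: cvg_app => A [n0 _ nA].
by apply: filterS (U_oo n0) => n /nA.
Qed.

Lemma ultra_le (u v : nat -> R) (a b : R) : u @ U --> a -> v @ U --> b ->
  (forall n, u n <= v n) -> a <= b.
Proof.
by move=> ua vb uv; apply: (ler_cvg_to ua vb); apply: filterE.
Qed.

Definition clamp (t : R) : R := Num.max 0 (Num.min t 1).

(* Clamped to [0, n], so that limits are defined and continuous on all of [R]. *)
Definition grid (n : nat) (t : R) : nat := minn (Num.trunc (n.+1%:R * t)) n.

Definition grid_pos (n k : nat) : R := k%:R / n.+1%:R.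

Lemma grid_le n t : (grid n t <= n)%N. Proof. exact: geq_minr. Qed.

Lemma clampE t : 0 <= t <= 1 -> clamp t = t.
Proof. by move=> /andP[t0 t1]; rewrite /clamp (min_l t1) max_r. Qed.

Lemma clamp_dist s t : `|clamp s - clamp t| <= `|s - t|.
Proof.
rewrite /clamp; have := ler_norm (s - t); have := ler_norm (t - s).
rewrite distrC => h1 h2; rewrite ler_norml.
have m01 : Num.max 0 1 = 1 :> R by rewrite max_r.
case: (leP s 1) => s1; case: (leP t 1) => t1; rewrite ?m01;
  case: (leP 0 s) => s0; case: (leP 0 t) => t0; apply/andP; split; lra.
Qed.

(** The nodes sit at [k / n.+1] and the families are used for [k <= n], so [t = 1] is represented by
    the node [n], which is just within the tolerance. *)
Lemma grid_dist n t : `|grid_pos n (grid n t) - clamp t| <= n.+1%:R^-1.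
Proof.
have n0 : 0 < n.+1%:R :> R by rewrite ltr0n.
have nS : n.+1%:R = n%:R + 1 :> R by rewrite -natr1.
have nV : 0 < n.+1%:R^-1 :> R by rewrite invr_gt0.
rewrite -(@ler_pM2l _ n.+1%:R)// mulfV ?gt_eqF// -[X in X * `|_|]gtr0_norm// -normrM mulrBr.
rewrite /grid_pos mulrCA mulfV ?gt_eqF// mulr1 /grid.
have [t0|t0] := ltP t 0.
  have -> : Num.trunc (n.+1%:R * t) = 0%N.
    apply/truncn0Pn; rewrite -ltNge (lt_le_trans _ (@ler01 R))//.
    by rewrite pmulr_rlt0.
  rewrite min0n /clamp (min_l (le_trans (ltW t0) (@ler01 R))) max_l ?ltW//.
  by rewrite mulr0 subrr normr0.
have tt := truncn_itv (mulr_ge0 (ltW n0) t0).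
set m := Num.trunc _ in tt *; case/andP: tt => t1 t2.
have [t_1|t_1] := leP t 1.
  rewrite clampE ?t0//.
  have [mn|mn] := leqP m n.
    by rewrite -natr1 in t2; rewrite ler_norml; apply/andP; split; lra.
  have : n.+1%:R <= m%:R :> R by rewrite ler_nat.
  by move=> h; rewrite ler_norml nS in h t1 *; apply/andP; split; nra.
rewrite /clamp (min_r (ltW t_1)) (max_r (@ler01 R)) mulr1.
have -> : minn m n = n.
  apply/minn_idPr; rewrite -ltnS -(ltr_nat R); apply: lt_trans t2.
  by rewrite nS; have := ler0n R n; nra.
by rewrite nS distrC addrAC subrr add0r normr1.
Qed.

Lemma grid_cvg t : (fun n => grid_pos n (grid n t)) @ U --> clamp t.
Proof.
apply/cvgrPdist_le => eps eps0.
have := ultra_inv; move/cvgrPdist_le => /(_ _ eps0); apply: filterS => n /=.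
rewrite sub0r normrN gtr0_norm ?invr_gt0// => h.
by rewrite distrC (le_trans (grid_dist n t)).
Qed.

Section Family.
Variables (f : nat -> nat -> R) (B L : R).
Hypothesis fB : forall n k, (k <= n)%N -> `|f n k| <= B.
Hypothesis fL : forall n k, (k < n)%N -> `|f n k.+1 - f n k| <= L / n.+1%:R.

Definition flim (t : R) : R := lim (f n (grid n t) @[n --> U]).

Lemma family_lip n i j : (i <= n)%N -> (j <= n)%N ->
  `|f n j - f n i| <= L * `|grid_pos n j - grid_pos n i|.
Proof.
wlog ij : i j / (i <= j)%N.
  move=> H; case: (leqP i j) => [ij|/ltnW ji] iN jN; first exact: H.
  by rewrite distrC [X in L * X]distrC; apply: H.
move=> iN jN; rewrite -telescope_sumr// (le_trans (ler_norm_sum _ _ _))//.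
apply: (@le_trans _ _ (\sum_(i <= k < j) L / n.+1%:R)).
  by apply: ler_sum_nat => k /andP[_ kj]; apply/fL/(leq_trans kj).
rewrite sumr_const_nat /grid_pos -mulrBl -natrB// normrM normr_nat.
rewrite [`|_^-1|]gtr0_norm ?invr_gt0// -mulr_natl.
by rewrite le_eqVlt; apply/orP; left; apply/eqP; ring.
Qed.

Lemma flim_cvg t : (fun n => f n (grid n t)) @ U --> flim t.
Proof.
have [|l _ fl] := @ultra_cvg (fun n => f n (grid n t)) B.
  by move=> n; exact/fB/grid_le.
by rewrite /flim (cvg_lim _ fl).
Qed.

(** By the uniform Lipschitz bound, any indices whose nodes tend to [t] give the limit at [t]. This
    covers neighbouring nodes, end nodes and indices selected by a mean value argument. *)
Lemma flim_seq (k_ : nat -> nat) (t : R) : 0 <= t <= 1 -> (forall n, (k_ n <= n)%N) ->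
  (fun n => grid_pos n (k_ n)) @ U --> t -> (fun n => f n (k_ n)) @ U --> flim t.
Proof.
move=> t01 kn kt.
have d0 : (fun n => L * `|grid_pos n (k_ n) - grid_pos n (grid n t)|) @ U --> (0 : R).
  rewrite -(mulr0 L) -(normr0 R); apply: cvgM; first exact: cvg_cst.
  have h : (fun n => grid_pos n (k_ n) - grid_pos n (grid n t)) @ U --> t - clamp t.
    by apply: cvgB => //; exact: grid_cvg.
  by rewrite clampE// subrr in h; exact: cvg_norm h.
apply/cvgrPdist_le => eps eps0; have e2 : 0 < eps / 2 by rewrite divr_gt0.
have /cvgrPdist_le/(_ _ e2) h1 := (@flim_cvg t).
have /cvgrPdist_le/(_ _ e2) h2 := d0.
apply: filterS2 h1 h2 => n /= h1; rewrite sub0r normrN => h2.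
have := family_lip (grid_le n t) (kn n); move: h2 => /(le_trans (ler_norm _)) => h2 h3.
rewrite (_ : _ - _ = (flim t - f n (grid n t)) - (f n (k_ n) - f n (grid n t))); last by ring.
by rewrite (le_trans (ler_normB _ _))// [eps]splitr lerD// (le_trans h3).
Qed.

Lemma flim_lip s t : `|flim s - flim t| <= L * `|s - t|.
Proof.
have L0 : 0 <= L.
  by have := @fL 1 0 isT => /(le_trans (normr_ge0 _)); rewrite pmulr_lge0// invr_gt0.
apply: (@le_trans _ _ (L * `|clamp s - clamp t|)); last by rewrite ler_wpM2l// clamp_dist.
apply: (@ultra_le (fun n => `|f n (grid n s) - f n (grid n t)|)
  (fun n => L * `|grid_pos n (grid n s) - grid_pos n (grid n t)|)).
- by apply: cvg_norm; apply: cvgB; exact: flim_cvg.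
- by apply: cvgM; [exact: cvg_cst|apply: cvg_norm; apply: cvgB; exact: grid_cvg].
- by move=> n; apply: family_lip; exact: grid_le.
Qed.

Lemma flim_continuous : continuous flim.
Proof.
move=> t; apply/cvgrPdist_le => eps eps0.
have K0 : 0 < `|L| + 1 by have := normr_ge0 L; lra.
exists (eps / (`|L| + 1)); first by rewrite /= divr_gt0.
move=> s /= st; rewrite (le_trans (flim_lip t s))//.
rewrite ltr_pdivlMr// in st; apply: le_trans (ltW st); rewrite mulrC ler_wpM2l//.
by have := ler_norm L; lra.
Qed.

Variables (T_ : nat -> R) (T : R) (g : nat -> nat -> R) (G : R -> R).
Hypothesis T_gt0 : forall n, 0 < T_ n.
Hypothesis T_cvg : T_ @ U --> T.
Hypothesis fg : forall n k, (k < n)%N -> f n k.+1 - f n k = T_ n / n.+1%:R * g n k.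
Hypothesis gG : forall (k_ : nat -> nat) (r : R), 0 <= r <= 1 ->
  (forall n, (k_ n <= n)%N) -> (\forall n \near U, (k_ n < n)%N) ->
  (fun n => grid_pos n (k_ n)) @ U --> r -> (fun n => g n (k_ n)) @ U --> G r.

(** A discrete mean value theorem: among the steps from [u] to [v] one has slope at least the
    average, and its node converges along [U] to some [r]. The hypothesis [gG] speaks of indices
    below [n] because the momentum increments involve the vertex [k.+1]. *)
Lemma flim_mean_le (u v : R) : 0 <= u -> u < v -> v <= 1 ->
  exists2 r, u <= r <= v & flim v - flim u <= T * G r * (v - u).
Proof.
move=> u0 uv v1.
(* If [u] and [v] share a node there is no step to choose and [0] is a placeholder; along [U] the
   two nodes are eventually separated. *)
have /choice[k_ Hk] n : exists k, (k <= n)%N /\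
   ((grid n u < grid n v)%N -> [/\ (grid n u <= k)%N, (k < grid n v)%N &
     f n (grid n v) - f n (grid n u) <=
       T_ n * g n k * (grid_pos n (grid n v) - grid_pos n (grid n u))]).
  have [ij|] := ltnP (grid n u) (grid n v); last by exists 0%N.
  set i := grid n u in ij *; set j := grid n v in ij *.
  have jn : (j <= n)%N by exact: grid_le.
  have TN : 0 < T_ n / n.+1%:R by rewrite divr_gt0.
  apply: contrapT => no.
  have lt k : (i <= k < j)%N -> T_ n / n.+1%:R * g n k < (f n j - f n i) / (j - i)%:R.
    move=> /andP[ik kj]; rewrite ltNge; apply/negP => le; apply: no; exists k.
    split; first by rewrite (leq_trans (ltnW kj)).
    move=> _; split => //.
    rewrite /grid_pos -mulrBl -natrB ?(ltnW ij)//.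
    move: le; rewrite ler_pdivrMr ?ltr0n ?subn_gt0// => /le_trans; apply.
    by rewrite le_eqVlt; apply/orP; left; apply/eqP; ring.
  suff : f n j - f n i < f n j - f n i by rewrite ltxx.
  rewrite -{1}telescope_sumr ?(ltnW ij)//.
  apply: (@lt_le_trans _ _ (\sum_(i <= k < j) (f n j - f n i) / (j - i)%:R)).
    apply: ltr_sum_nat => // k kij; rewrite fg; first exact: lt.
    by case/andP: kij => _ kj; rewrite (leq_trans kj).
  rewrite sumr_const_nat -[leLHS]mulr_natl mulrC divfK//.
  by rewrite pnatr_eq0 subn_eq0 -ltnNge.
have [|r rB kr] := @ultra_cvg (fun n => grid_pos n (k_ n)) 1.
  move=> n; rewrite ger0_norm ?divr_ge0// ler_pdivrMr ?ltr0n// mul1r ler_nat.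
  by rewrite leqW//; have [] := Hk n.
have cu := (@grid_cvg u); have cv := (@grid_cvg v).
rewrite clampE in cu; last by rewrite u0 (le_trans (ltW uv)).
rewrite clampE in cv; last by rewrite v1 (le_trans u0 (ltW uv)).
have ev : \forall n \near U, (grid n u < grid n v)%N.
  have m1 : u < (u + v) / 2 by lra.
  have m2 : (u + v) / 2 < v by lra.
  have h1 : \forall n \near U, grid_pos n (grid n u) < (u + v) / 2 by exact: (cvgr_lt u).
  have h2 : \forall n \near U, (u + v) / 2 < grid_pos n (grid n v) by exact: (cvgr_gt v).
  apply: filterS2 h1 h2 => n h1 h2; have := lt_trans h1 h2.
  by rewrite /grid_pos ltr_pM2r ?invr_gt0// ltr_nat.
have ur : u <= r.
  apply: (ler_cvg_to cu kr); apply: filterS ev => n uvn.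
  have [_ /(_ uvn)[h _ _]] := Hk n.
  by rewrite /grid_pos ler_pM2r ?invr_gt0// ler_nat.
have rv : r <= v.
  apply: (ler_cvg_to kr cv); apply: filterS ev => n uvn.
  have [_ /(_ uvn)[_ h _]] := Hk n.
  by rewrite /grid_pos ler_pM2r ?invr_gt0// ler_nat ltnW.
exists r; first by rewrite ur.
have r01 : 0 <= r <= 1 by rewrite (le_trans u0)//= (le_trans rv).
apply: (ler_cvg_to (cvgB (@flim_cvg v) (@flim_cvg u))
  (cvgM (cvgM T_cvg (gG r01 _ _ kr)) (cvgB cv cu))).
- by move=> n; have [] := Hk n.
- apply: filterS ev => n uvn; have [_ /(_ uvn)[_ h _]] := Hk n.
  by rewrite (leq_trans h)// grid_le.
- by apply: filterS ev => n uvn; have [_ /(_ uvn)[_ _ h]] := Hk n.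
Qed.

End Family.

Section FamilyDerive.
Variables (f : nat -> nat -> R) (B : R).
Hypothesis fB : forall n k, (k <= n)%N -> `|f n k| <= B.
Variables (T_ : nat -> R) (T : R) (g : nat -> nat -> R) (G : R -> R).
Hypothesis T_gt0 : forall n, 0 < T_ n.
Hypothesis T_cvg : T_ @ U --> T.
Hypothesis fg : forall n k, (k < n)%N -> f n k.+1 - f n k = T_ n / n.+1%:R * g n k.
Hypothesis gG : forall (k_ : nat -> nat) (r : R), 0 <= r <= 1 ->
  (forall n, (k_ n <= n)%N) -> (\forall n \near U, (k_ n < n)%N) ->
  (fun n => grid_pos n (k_ n)) @ U --> r -> (fun n => g n (k_ n)) @ U --> G r.

Lemma flimN t : flim (fun n k => - f n k) t = - flim f t.
Proof. by apply: (@cvg_lim R) => //; apply: cvgN; exact: (flim_cvg fB). Qed.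

Lemma flim_mean_ge (u v : R) : 0 <= u -> u < v -> v <= 1 ->
  exists2 r, u <= r <= v & T * G r * (v - u) <= flim f v - flim f u.
Proof.
move=> u0 uv v1.
have [|||r ruv] := @flim_mean_le (fun n k => - f n k) B _ T_ T
  (fun n k => - g n k) (fun r => - G r) T_gt0 T_cvg _ _ u v u0 uv v1.
- by move=> n k kn; rewrite normrN fB.
- by move=> n k kn; rewrite -opprD fg// mulrN.
- by move=> k_ r r01 kn kn' kr; apply: cvgN; exact: gG.
by rewrite !flimN => h; exists r => //; lra.
Qed.

Lemma flim_derive (t : R) : 0 < t < 1 -> continuous_at t G ->
  is_derive t 1 (flim f) (T * G t).
Proof.
move=> t01 cG; apply: (@is_derive_mean _ _ (fun r => T * G r) 0 1) => //; last first.
  by apply: cvgM => //; exact: cvg_cst.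
move=> u v u0 uv v1; have [r ruv h] := flim_mean_ge u0 uv v1.
have [r' ruv' h'] := flim_mean_le fB T_gt0 T_cvg fg gG u0 uv v1.
by exists r, r'; split => //; rewrite h h'.
Qed.

End FamilyDerive.

End UltraLimit.

(** * Uniform bounds and the limit orbit *)

Lemma continuous2_bounded (R : realType) (F : R -> R -> R) (B : R) :
  (forall x y : R, F z.1 z.2 @[z --> (x, y)] --> F x y) ->
  exists2 K : R, 0 <= K & forall x y, `|x| <= B -> `|y| <= B -> `|F x y| <= K.
Proof.
move=> cF; have [B0|B0] := leP 0 B; last first.
  by exists 0 => // x y /(le_lt_trans)/(_ B0); rewrite normr_lt0.
pose A : set (R * R) := `[- B, B] `*` `[- B, B].
have A0 : A !=set0 by exists (0, 0); split => /=; rewrite in_itv/= oppr_le0 B0.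
have cA : compact A by apply: compact_setX; exact: segment_compact.
have [] := @compact_EVT_max _ R (fun z => `|F z.1 z.2|) A A0 cA.
  apply: continuous_subspaceT => -[x y]; exact: (cvg_norm (cF x y)).
move=> z _ zmax; exists `|F z.1 z.2| => // x y xB yB.
by apply: (zmax (x, y)); rewrite inE; split; rewrite /= in_itv/= -ler_norml.
Qed.

Section MomentumBound.
Variables (R : realType) (W : R -> R -> R) (c C0 M Tlo : R).
Hypotheses (W_ge0 : forall x y : R, 0 <= W x y) (c_gt0 : 0 < c) (C0_ge0 : 0 <= C0).
Hypotheses (M_gt0 : 0 < M) (Tlo_gt0 : 0 < Tlo).
Variables (n : nat) (tau : R) (X Y : nat -> R).
Hypotheses (tau_gt0 : 0 < tau) (SM : disc_action W c n.+1 tau X Y <= M).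
Hypothesis T_ge : Tlo <= n.+1%:R * tau.
Let D := M + (2^-1 + C0) * (M / c).

(* Some momentum is at most the mean, and the increments are summable. *)
Lemma momentum_bound (u v : nat -> R) (K : R) : 0 <= K ->
  \sum_(k < n.+1) tau * `|u k| <= D -> \sum_(k < n.+1) tau * `|v k| <= D ->
  (forall j, (j < n)%N -> `|u j.+1 - u j| <= tau * (`|v j.+1| + K)) ->
  forall k, (k <= n)%N -> `|u k| <= D / Tlo + (D + K * (M / c)).
Proof.
move=> K0 uD vD uv k kn.
have D0 : 0 <= D by apply: le_trans uD; apply: sumr_ge0 => i _; rewrite mulr_ge0// ltW.
have TM := time_le W_ge0 c_gt0 tau_gt0 SM.
have [k0 k0n uk0] : exists2 k0, (k0 <= n)%N & `|u k0| <= D / Tlo.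
  apply: contrapT => no.
  have : n.+1%:R * (tau * (D / Tlo)) < \sum_(k < n.+1) tau * `|u k|.
    rewrite -sum_const_ord; apply: ltr_sum.
      by apply/hasP; exists ord0 => //; rewrite mem_index_enum.
    move=> i _; rewrite ltr_pM2l// ltNge; apply/negP => ?; apply: no.
    by exists i => //; rewrite -ltnS.
  move=> /lt_le_trans/(_ uD); rewrite ltNge => /negP; apply.
  by rewrite mulrA mulrA ler_pdivlMr// mulrC ler_wpM2r.
have h := @norm_telescope_le _ u (fun j => tau * (`|v j.+1| + K)) n k0 k k0n kn uv.
have h2 : \sum_(j < n) tau * (`|v j.+1| + K) <= D + K * (M / c).
  under eq_bigr do rewrite mulrDr; rewrite big_split/= sum_const_ord; apply: lerD.
    by apply: le_trans vD; rewrite big_ord_recl lerDr mulr_ge0// ltW.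
  rewrite mulrA mulrC ler_wpM2l//; apply: le_trans TM; rewrite ler_pM2r//.
  by rewrite ler_nat.
have := ler_normD (u k0) (u k - u k0); rewrite addrC subrK; lra.
Qed.

End MomentumBound.

Section Orbit.
Variables (R : realType) (W Wx Wy : R -> R -> R) (c C0 a0 b0 a1 b1 : R).
Hypotheses (Wx_der : forall x y : R, is_derive x 1 (W ^~ y) (Wx x y)).
Hypotheses (Wy_der : forall x y : R, is_derive y 1 (W x) (Wy x y)).
Hypotheses (W_cont : forall x y : R, W z.1 z.2 @[z --> (x, y)] --> W x y).
Hypotheses (Wx_cont : forall x y : R, Wx z.1 z.2 @[z --> (x, y)] --> Wx x y).
Hypotheses (Wy_cont : forall x y : R, Wy z.1 z.2 @[z --> (x, y)] --> Wy x y).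
Hypotheses (W_ge0 : forall x y : R, 0 <= W x y) (c_gt0 : 0 < c) (C0_ge0 : 0 <= C0).
Hypotheses (xW : forall x y : R, `|x| <= W x y + C0)
  (yW : forall x y : R, `|y| <= W x y + C0).
Hypotheses (neq : (a0 != a1) || (b0 != b1)).

(** The bounds [Tlo], [Thi], [B] and [P] are fixed before [n], as the limit requires. [T_ n] is the
    whole time, cut into [n.+1] steps. *)
Lemma exists_bounded_discrete_orbits : exists (Tlo Thi B P : R) (T_ : nat -> R)
    (X_ Y_ P_ Q_ : nat -> nat -> R),
  [/\ 0 < Tlo, forall n, Tlo <= T_ n <= Thi,
      forall n k, (k <= n)%N -> [/\ `|X_ n k| <= B, `|Y_ n k| <= B,
        `|P_ n k| <= P & `|Q_ n k| <= P] &
      forall n, [/\ X_ n 0%N = a0, Y_ n 0%N = b0, X_ n n.+1 = a1 & Y_ n n.+1 = b1] ] /\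
  [/\ forall n k, (k <= n)%N -> 
        X_ n k.+1 - X_ n k = T_ n / n.+1%:R * (P_ n k + Y_ n k) /\
        Y_ n k.+1 - Y_ n k = T_ n / n.+1%:R * (Q_ n k - X_ n k),
      forall n k, (k < n)%N ->
        P_ n k.+1 - P_ n k = T_ n / n.+1%:R * (Q_ n k.+1 + Wx (X_ n k.+1) (Y_ n k.+1)) /\
        Q_ n k.+1 - Q_ n k = T_ n / n.+1%:R * (- P_ n k.+1 + Wy (X_ n k.+1) (Y_ n k.+1)) &
      forall n, \sum_(k < n.+1) (P_ n k ^+ 2 / 2 + Q_ n k ^+ 2 / 2 + P_ n k * Y_ n k
        - Q_ n k * X_ n k - W (X_ n k) (Y_ n k)) = n.+1%:R * c].
Proof.
have [m m0 mW] := continuous2_bounded (`|a0| + `|a1| + (`|b0| + `|b1|)) W_cont.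
pose M := (`|a1 - a0| + (`|b0| + `|b1|)) ^+ 2 / 2 +
  (`|b1 - b0| + (`|a0| + `|a1|)) ^+ 2 / 2 + m + c.
have M0 : 0 < M by rewrite /M ltr_wpDl// !addr_ge0// mulr_ge0// sqr_ge0.
have line s : 0 <= s <= 1 -> W (a0 + s * (a1 - a0)) (b0 + s * (b1 - b0)) <= m.
  move=> s01; apply: le_trans (ler_norm _) _; apply: mW.
    by rewrite (le_trans (norm_convex_le _ _ s01))// lerDl addr_ge0.
  by rewrite (le_trans (norm_convex_le _ _ s01))// lerDr addr_ge0.
have orb n := exists_discrete_orbit W_cont Wx_der Wy_der W_ge0 c_gt0 C0_ge0 xW yW
  M0 neq line (lexx M) (ltn0Sn n).
have /choice[tau_ orb1] := orb.
have /choice[X_ orb2] := orb1.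
have /choice[Y_ orb3] := orb2.
pose B := box_size c C0 M a0 b0.
have [G1 G10 WxB] := continuous2_bounded B Wx_cont.
have [G2 G20 WyB] := continuous2_bounded B Wy_cont.
pose Tlo := min_time c C0 M a0 b0 a1 b1.
have Tlo0 : 0 < Tlo by exact: min_time_gt0.
pose D := M + (2^-1 + C0) * (M / c).
have ap n := let: And5 t j s _ _ := orb3 n in
  a_priori_bounds W_ge0 c_gt0 C0_ge0 xW yW M0 neq t j s.
have Tn n : n.+1%:R * tau_ n / n.+1%:R = tau_ n.
  by rewrite mulrC mulKf// pnatr_eq0.
exists Tlo, (M / c), B, (D / Tlo + (D + (G1 + G2) * (M / c))),
  (fun n => n.+1%:R * tau_ n), X_, Y_,
  (fun n => disc_px (tau_ n) (X_ n) (Y_ n)), (fun n => disc_py (tau_ n) (X_ n) (Y_ n)).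
split.
  split => //.
  - by move=> n; have [h _ _] := ap n.
  - move=> n k kn; have [t0 j SM EL _] := orb3 n.
    have [/andP[T1 _] XB YB] := ap n.
    have pD := px_sum_le W_ge0 c_gt0 C0_ge0 t0 SM.
    have qD := py_sum_le W_ge0 c_gt0 C0_ge0 t0 SM.
    have G0 : 0 <= G1 + G2 by rewrite addr_ge0.
    split; [by apply: XB; exact: leqW|by apply: YB; exact: leqW| |].
    + apply: (momentum_bound W_ge0 c_gt0 Tlo0 t0 SM T1 G0 pD qD) => // i i_n.
      have [-> _] := EL i i_n; rewrite normrM gtr0_norm// ler_pM2l//.
      rewrite (le_trans (ler_normD _ _))// lerD2l (le_trans (WxB _ _ _ _)) ?lerDl//.
        by apply: XB; rewrite ltnW.
      by apply: YB; rewrite ltnW.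
    + apply: (momentum_bound W_ge0 c_gt0 Tlo0 t0 SM T1 G0 qD pD) => // i i_n.
      have [_ ->] := EL i i_n; rewrite normrM gtr0_norm// ler_pM2l//.
      rewrite (le_trans (ler_normD _ _))// normrN lerD2l (le_trans (WyB _ _ _ _)) ?lerDr//.
        by apply: XB; rewrite ltnW.
      by apply: YB; rewrite ltnW.
  - by move=> n; have [_ []] := orb3 n.
split.
- move=> n k kn; rewrite Tn; have [t0 _ _ _ _] := orb3 n.
  by split; [exact: step_xE|exact: step_yE].
- by move=> n k kn; rewrite Tn; have [_ _ _ EL _] := orb3 n; exact: EL.
- by move=> n; have [_ _ _ _ ->] := orb3 n.
Qed.

End Orbit.

Section LimitOrbit.
Variables (R : realType) (W Wx Wy : R -> R -> R) (c C0 a0 b0 a1 b1 : R).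
Hypotheses (Wx_der : forall x y : R, is_derive x 1 (W ^~ y) (Wx x y)).
Hypotheses (Wy_der : forall x y : R, is_derive y 1 (W x) (Wy x y)).
Hypotheses (W_cont : forall x y : R, W z.1 z.2 @[z --> (x, y)] --> W x y).
Hypotheses (Wx_cont : forall x y : R, Wx z.1 z.2 @[z --> (x, y)] --> Wx x y).
Hypotheses (Wy_cont : forall x y : R, Wy z.1 z.2 @[z --> (x, y)] --> Wy x y).
Hypotheses (W_ge0 : forall x y : R, 0 <= W x y) (c_gt0 : 0 < c) (C0_ge0 : 0 <= C0).
Hypotheses (xW : forall x y : R, `|x| <= W x y + C0)
  (yW : forall x y : R, `|y| <= W x y + C0).
Hypotheses (neq : (a0 != a1) || (b0 != b1)).

(* The limit has constant energy.  The constant is [c], because each polygon has a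
   step of energy at least [c] and one of energy at most [c]. *)
Lemma exists_orbit : exists (T : R) (x y p q : R -> R),
  [/\ continuous x, continuous y, continuous p & continuous q] /\
  [/\ x 0 = a0, y 0 = b0, x 1 = a1 & y 1 = b1] /\
  (forall t : R, 0 < t < 1 ->
   [/\ is_derive t 1 x (T * (p t + y t)), is_derive t 1 y (T * (q t - x t)),
      is_derive t 1 p (T * (q t + Wx (x t) (y t))) &
      is_derive t 1 q (T * (- p t + Wy (x t) (y t)))]) /\
  (forall t : R, 0 <= t <= 1 ->
    p t ^+ 2 / 2 + q t ^+ 2 / 2 + p t * y t - q t * x t - W (x t) (y t) = c) /\
  0 < T.
Proof.
have [Tlo [Thi [B [Pb [T_ [X_ [Y_ [P_ [Q_ [[Tlo0 TB bd ends] [stepX stepP en]]]]]]]]]]] :=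
  exists_bounded_discrete_orbits Wx_der Wy_der W_cont Wx_cont Wy_cont W_ge0 c_gt0
    C0_ge0 xW yW neq.
(* An ultrafilter finer than [\oo], so that limits along it ignore finitely many [n]. *)
have [U [UU ooU]] := @ultraFilterLemma nat \oo _.
have U_oo n0 : U [set n | (n0 <= n)%N] by apply: ooU; exists n0.
have T_gt0 n : 0 < T_ n by have /andP[h _] := TB n; exact: lt_le_trans h.
have [|T _ T_cvg] := @ultra_cvg R U UU T_ Thi.
  by move=> n; have /andP[_ h] := TB n; rewrite gtr0_norm.
have T0 : 0 < T.
  apply: (lt_le_trans Tlo0); apply: (@ler_cvg_to _ U _ _ (fun=> Tlo) T_) => //.
    exact: cvg_cst.
  by apply: filterE => n; have /andP[] := TB n.
have [G1 G10 WxB] := continuous2_bounded B Wx_cont.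
have [G2 G20 WyB] := continuous2_bounded B Wy_cont.
have B0 : 0 <= B by have [h _ _ _] := bd 0%N 0%N isT; exact: le_trans h.
have Pb0 : 0 <= Pb by have [_ _ h _] := bd 0%N 0%N isT; exact: le_trans h.
have Thi0 : 0 < Thi by have /andP[h1 h2] := TB 0%N; apply: lt_le_trans (le_trans h1 h2).
pose L := Thi * (Pb + B + G1 + G2).
have stepL (d v : R) n : d = T_ n / n.+1%:R * v -> `|v| <= Pb + B + G1 + G2 ->
    `|d| <= L / n.+1%:R.
  move=> -> vb; rewrite normrM gtr0_norm ?divr_gt0// /L mulrAC.
  rewrite ler_pM2r ?invr_gt0//; apply: ler_pM => //; first exact: ltW.
  by have /andP[] := TB n.
have XB n k : (k <= n)%N -> `|X_ n k| <= B by move=> /bd[].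
have YB n k : (k <= n)%N -> `|Y_ n k| <= B by move=> /bd[].
have PB n k : (k <= n)%N -> `|P_ n k| <= Pb by move=> /bd[].
have QB n k : (k <= n)%N -> `|Q_ n k| <= Pb by move=> /bd[].
have XL' n k : (k <= n)%N -> `|X_ n k.+1 - X_ n k| <= L / n.+1%:R.
  move=> kn; have [s _] := stepX n k kn; apply: (stepL _ _ _ s).
  rewrite (le_trans (ler_normD _ _))//.
  by have := PB _ _ kn; have := YB _ _ kn; lra.
have YL' n k : (k <= n)%N -> `|Y_ n k.+1 - Y_ n k| <= L / n.+1%:R.
  move=> kn; have [_ s] := stepX n k kn; apply: (stepL _ _ _ s).
  rewrite (le_trans (ler_normB _ _))//.
  by have := QB _ _ kn; have := XB _ _ kn; lra.
have XL n k : (k < n)%N -> `|X_ n k.+1 - X_ n k| <= L / n.+1%:R by move=> /ltnW; exact: XL'.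
have YL n k : (k < n)%N -> `|Y_ n k.+1 - Y_ n k| <= L / n.+1%:R by move=> /ltnW; exact: YL'.
have PL n k : (k < n)%N -> `|P_ n k.+1 - P_ n k| <= L / n.+1%:R.
  move=> kn; have [s _] := stepP n k kn; apply: (stepL _ _ _ s).
  rewrite (le_trans (ler_normD _ _))//.
  by have := QB _ _ kn; have := WxB _ _ (XB _ _ kn) (YB _ _ kn); lra.
have QL n k : (k < n)%N -> `|Q_ n k.+1 - Q_ n k| <= L / n.+1%:R.
  move=> kn; have [_ s] := stepP n k kn; apply: (stepL _ _ _ s).
  rewrite (le_trans (ler_normD _ _))// normrN.
  by have := PB _ _ kn; have := WyB _ _ (XB _ _ kn) (YB _ _ kn); lra.
pose x := flim U X_; pose y := flim U Y_; pose p := flim U P_; pose q := flim U Q_.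
have cx : continuous x by exact: flim_continuous XB XL.
have cy : continuous y by exact: flim_continuous YB YL.
have cp : continuous p by exact: flim_continuous PB PL.
have cq : continuous q by exact: flim_continuous QB QL.
(* The momentum equations are evaluated at the next vertex, whose node has the same limit. The cap
   keeps the index in the range [k <= n]. *)
have succ_seq (k_ : nat -> nat) (r : R) : (forall n, (k_ n <= n)%N) ->
    (fun n => grid_pos R n (k_ n)) @ U --> r ->
    (fun n => grid_pos R n (minn (k_ n).+1 n)) @ U --> r.
  move=> kn kr; apply/cvgrPdist_le => eps eps0; have e2 : 0 < eps / 2 by rewrite divr_gt0.
  have /cvgrPdist_le/(_ _ e2) h1 := kr.
  have /cvgrPdist_le/(_ _ e2) h2 := @ultra_inv R U UU U_oo.
  apply: filterS2 h1 h2 => n /= h1; rewrite sub0r normrN gtr0_norm ?invr_gt0// => h2.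
  have : `|grid_pos R n (k_ n) - grid_pos R n (minn (k_ n).+1 n)| <= n.+1%:R^-1.
    rewrite distrC /grid_pos -mulrBl -natrB; last by rewrite leq_min leqnSn kn.
    rewrite normrM normr_nat gtr0_norm ?invr_gt0// ler_piMl ?invr_ge0// lern1.
    by rewrite leq_subLR addn1 geq_minl.
  move=> h3; have := ler_normD (r - grid_pos R n (k_ n))
    (grid_pos R n (k_ n) - grid_pos R n (minn (k_ n).+1 n)).
  rewrite addrA subrK; move=> h4; rewrite (le_trans h4)// [eps]splitr lerD// (le_trans h3)//.
have xder (t : R) : 0 < t < 1 -> is_derive t 1 x (T * (p t + y t)).
  move=> t01; apply: (@flim_derive R U UU U_oo X_ B XB T_ T
    (fun n k => P_ n k + Y_ n k)
    (fun t => p t + y t) T_gt0 T_cvg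
    (fun n k kn => (stepX n k (ltnW kn)).1)) => //; last by apply: cvgD; [exact: cp|exact: cy].
  move=> k_ r r01 kn _ kr; apply: cvgD.
    exact: (flim_seq U_oo PB PL r01 kn kr).
  exact: (flim_seq U_oo YB YL r01 kn kr).
have yder (t : R) : 0 < t < 1 -> is_derive t 1 y (T * (q t - x t)).
  move=> t01; apply: (@flim_derive R U UU U_oo Y_ B YB T_ T
    (fun n k => Q_ n k - X_ n k)
    (fun t => q t - x t) T_gt0 T_cvg
    (fun n k kn => (stepX n k (ltnW kn)).2)) => //; last by apply: cvgB; [exact: cq|exact: cx].
  move=> k_ r r01 kn _ kr; apply: cvgB.
    exact: (flim_seq U_oo QB QL r01 kn kr).
  exact: (flim_seq U_oo XB XL r01 kn kr).
(* Where [k_ n < n] the cap has no effect, so it can be removed in the limit. *)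
have shift (f : nat -> nat -> R) (k_ : nat -> nat) (l : R) :
    (\forall n \near U, (k_ n < n)%N) ->
    (fun n => f n (minn (k_ n).+1 n)) @ U --> l -> (fun n => f n (k_ n).+1) @ U --> l.
  move=> kn; apply: cvg_trans; apply: near_eq_cvg.
  by apply: filterS kn => n kn; rewrite (minn_idPl kn).
have pder (t : R) : 0 < t < 1 -> is_derive t 1 p (T * (q t + Wx (x t) (y t))).
  move=> t01; apply: (@flim_derive R U UU U_oo P_ Pb PB T_ T
    (fun n k => Q_ n k.+1 + Wx (X_ n k.+1) (Y_ n k.+1))
    (fun t => q t + Wx (x t) (y t)) T_gt0 T_cvg
    (fun n k kn => (stepP n k kn).1)) => //.
    move=> k_ r r01 kn kn' kr; have kr' := succ_seq _ _ kn kr.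
    have kn1 n : (minn (k_ n).+1 n <= n)%N by exact: geq_minr.
    apply: cvgD; first exact: (shift _ _ _ kn' (flim_seq U_oo QB QL r01 kn1 kr')).
    apply: (@continuous2_cvg nat R R R U _ _ _ Wx) => //.
      exact: (shift _ _ _ kn' (flim_seq U_oo XB XL r01 kn1 kr')).
    exact: (shift _ _ _ kn' (flim_seq U_oo YB YL r01 kn1 kr')).
  apply: cvgD; first exact: cq.
  by apply: (@continuous2_cvg R R R R _ _ x y Wx) => //; [exact: cx|exact: cy].
have qder (t : R) : 0 < t < 1 -> is_derive t 1 q (T * (- p t + Wy (x t) (y t))).
  move=> t01; apply: (@flim_derive R U UU U_oo Q_ Pb QB T_ T
    (fun n k => - P_ n k.+1 + Wy (X_ n k.+1) (Y_ n k.+1))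
    (fun t => - p t + Wy (x t) (y t)) T_gt0 T_cvg
    (fun n k kn => (stepP n k kn).2)) => //.
    move=> k_ r r01 kn kn' kr; have kr' := succ_seq _ _ kn kr.
    have kn1 n : (minn (k_ n).+1 n <= n)%N by exact: geq_minr.
    apply: cvgD; first by apply: cvgN; exact: (shift _ _ _ kn' (flim_seq U_oo PB PL r01 kn1 kr')).
    apply: (@continuous2_cvg nat R R R U _ _ _ Wy) => //.
      exact: (shift _ _ _ kn' (flim_seq U_oo XB XL r01 kn1 kr')).
    exact: (shift _ _ _ kn' (flim_seq U_oo YB YL r01 kn1 kr')).
  apply: cvgD; first by apply: cvgN; exact: cp.
  by apply: (@continuous2_cvg R R R R _ _ x y Wy) => //; [exact: cx|exact: cy].
have pos0 : (fun n => grid_pos R n 0) @ U --> (0 : R).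
  rewrite (_ : (fun n => grid_pos R n 0) = fun=> 0); first exact: cvg_cst.
  by apply/funext => n; rewrite /grid_pos mul0r.
have pos1 : (fun n => grid_pos R n n) @ U --> (1 : R).
  have h : (fun n : nat => 1 - n.+1%:R^-1 : R) @ U --> (1 - 0 : R).
    by apply: cvgB; [exact: cvg_cst|exact: ultra_inv].
  rewrite subr0 in h; apply: cvg_trans h; apply: near_eq_cvg; apply: filterE => n.
  rewrite /grid_pos -[X in (X - _) = _](@divff _ n.+1%:R)//.
  by rewrite -{2}[n.+1%:R^-1]mul1r -mulrBl -natr1 addrK.
have r0 : 0 <= (0 : R) <= 1 by rewrite lexx ler01.
have r1 : 0 <= (1 : R) <= 1 by rewrite lexx ler01.
have uniq (u : nat -> R) (l l' : R) : u @ U --> l -> u @ U --> l' -> l = l'.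
  by move=> h1 h2; rewrite -(cvg_lim (@norm_hausdorff _ _) h1) (cvg_lim (@norm_hausdorff _ _) h2).
have end0 (f : nat -> nat -> R) (a l : R) : (forall n, f n 0%N = a) ->
    (fun n => f n 0%N) @ U --> l -> l = a.
  move=> fa; rewrite (_ : (fun n => f n 0%N) = fun=> a); last exact/funext.
  by move=> al; apply: (uniq _ _ _ al); exact: cvg_cst.
(* The final vertex [n.+1] lies beyond the indices used in the limit; the last step, of size at most
   [L / n.+1], carries the limit over to it. *)
have end1 (f : nat -> nat -> R) (a l : R) : (forall n, f n n.+1 = a) ->
    (forall n k, (k <= n)%N -> `|f n k.+1 - f n k| <= L / n.+1%:R) ->
    (fun n => f n n) @ U --> l -> l = a.
  move=> fa fL fl; apply: (uniq _ _ _ fl); apply/cvgrPdist_le => eps eps0.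
  have h : (fun n : nat => L * n.+1%:R^-1 : R) @ U --> (L * 0 : R).
    by apply: cvgM; [exact: cvg_cst|exact: ultra_inv].
  rewrite mulr0 in h; have /cvgrPdist_le/(_ _ eps0) h1 := h.
  apply: filterS h1 => n /=; rewrite sub0r normrN => /(le_trans (ler_norm _)).
  by apply: le_trans; rewrite -(fa n); exact: fL.
have nn (n : nat) : (n <= n)%N by [].
have n0 (n : nat) : (0 <= n)%N by [].
pose E t := p t ^+ 2 / 2 + q t ^+ 2 / 2 + p t * y t - q t * x t - W (x t) (y t).
(* The limit solves an autonomous Hamiltonian system, so its energy is conserved. *)
have Eder (t : R) : 0 < t < 1 -> is_derive t 1 E 0.
  move=> t01; have dx := xder t t01; have dy := yder t t01.
  have dp := pder t t01; have dq := qder t t01.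
  have dW := is_derive_chain2 Wx_der Wy_der (@Wx_cont (x t) (y t)) (@Wy_cont (x t) (y t)) dx dy.
  by apply: is_derive_eq; rewrite /GRing.scale/=; field.
have cE : continuous E.
  move=> t; rewrite /E; apply: cvgB; last first.
    by apply: (@continuous2_cvg R R R R _ _ x y W) => //; [exact: cx|exact: cy].
  have sqr (f : R -> R) : continuous f -> (fun t => f t ^+ 2 / 2) @ t --> f t ^+ 2 / 2.
    move=> cf; apply: cvgM; last exact: cvg_cst.
    by rewrite expr2; apply: cvgM; exact: cf.
  apply: cvgB; last by apply: cvgM; [exact: cq|exact: cx].
  apply: cvgD; last by apply: cvgM; [exact: cp|exact: cy].
  by apply: cvgD; exact: sqr.
have Ecst (s t : R) : 0 <= s -> s < t -> t <= 1 -> E s = E t.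
  move=> s0 st t1; have [||z _ /eqP] := @MVT R E (fun=> 0) s t st.
  - move=> z; rewrite in_itv/= => /andP[z1 z2]; apply: Eder.
    by rewrite (le_lt_trans s0)// (lt_le_trans z2).
  - exact: continuous_subspaceT.
  - by rewrite mul0r subr_eq0 => /eqP ->.
have Ecst2 (s t : R) : 0 <= s <= 1 -> 0 <= t <= 1 -> E s = E t.
  move=> /andP[s0 s1] /andP[t0 t1]; have [st|ts|->//] := ltgtP s t; first exact: Ecst.
  by apply/esym/Ecst.
pose H n k := P_ n k ^+ 2 / 2 + Q_ n k ^+ 2 / 2 + P_ n k * Y_ n k
        - Q_ n k * X_ n k - W (X_ n k) (Y_ n k).
have Hcvg (k_ : nat -> nat) (r : R) : (forall n, (k_ n <= n)%N) -> 0 <= r <= 1 ->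
    (fun n => grid_pos R n (k_ n)) @ U --> r -> (fun n => H n (k_ n)) @ U --> E r.
  move=> kn r01 kr.
  have c1 : (fun n => X_ n (k_ n)) @ U --> x r by exact: (flim_seq U_oo XB XL r01 kn kr).
  have c2 : (fun n => Y_ n (k_ n)) @ U --> y r by exact: (flim_seq U_oo YB YL r01 kn kr).
  have c3 : (fun n => P_ n (k_ n)) @ U --> p r by exact: (flim_seq U_oo PB PL r01 kn kr).
  have c4 : (fun n => Q_ n (k_ n)) @ U --> q r by exact: (flim_seq U_oo QB QL r01 kn kr).
  rewrite /H /E; apply: cvgB; last by apply: (@continuous2_cvg nat R R R U _ _ _ W).
  have sqr (f : nat -> R) (l : R) : f @ U --> l -> (fun t => f t ^+ 2 / 2) @ U --> l ^+ 2 / 2.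
    move=> cf; apply: cvgM; last exact: cvg_cst.
    by rewrite expr2; apply: cvgM; exact: cf.
  apply: cvgB; last exact: cvgM.
  apply: cvgD; last exact: cvgM.
  by apply: cvgD; exact: sqr.
(* The steps selected by the mean energy may sit anywhere; their nodes converge along [U], and since
   [E] is constant the place of the limit does not matter. *)
have posB (k_ : nat -> nat) : (forall n, (k_ n <= n)%N) ->
    exists2 r : R, 0 <= r <= 1 & (fun n => grid_pos R n (k_ n)) @ U --> r.
  move=> kn; have h01 n : 0 <= grid_pos R n (k_ n) <= 1.
    by rewrite divr_ge0// ler_pdivrMr ?ltr0n// mul1r ler_nat leqW.
  have [|r _ kr] := @ultra_cvg R U UU (fun n => grid_pos R n (k_ n)) 1.
    by move=> n; have /andP[h1 h2] := h01 n; rewrite ger0_norm.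
  exists r => //; apply/andP; split.
    apply: (@ler_cvg_to _ U _ _ (fun=> 0) _ _ _ (cvg_cst _) kr).
    by apply: filterE => n; have /andP[] := h01 n.
  apply: (@ler_cvg_to _ U _ _ _ (fun=> 1) _ _ kr (cvg_cst _)).
  by apply: filterE => n; have /andP[] := h01 n.
have Ec : E 0 = c.
  have /choice[k1 Hk1] n : exists k, (k <= n)%N /\ c <= H n k.
    have [||k kn ck] := @exists_ge_mean _ (H n) n.+1 c; [by []|by rewrite /H en|].
    by exists k.
  have /choice[k2 Hk2] n : exists k, (k <= n)%N /\ H n k <= c.
    have [||k kn ck] := @exists_ge_mean _ (fun k => - H n k) n.+1 (- c); first by [].
      by rewrite sumrN /H en mulrN.
    by exists k; split => //; rewrite -lerN2.
  have [|r r01 kr] := posB k1; first by move=> n; have [] := Hk1 n.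
  have [|r' r01' kr'] := posB k2; first by move=> n; have [] := Hk2 n.
  apply/eqP; rewrite eq_le; apply/andP; split.
    rewrite (Ecst2 0 r')//.
    apply: (@ler_cvg_to _ U _ _ _ (fun=> c) _ _ (Hcvg _ _ _ r01' kr') (cvg_cst _)).
      by move=> n; have [] := Hk2 n.
    by apply: filterE => n; have [] := Hk2 n.
  rewrite (Ecst2 0 r)//.
  apply: (@ler_cvg_to _ U _ _ (fun=> c) _ _ _ (cvg_cst _) (Hcvg _ _ _ r01 kr)).
    by move=> n; have [] := Hk1 n.
  by apply: filterE => n; have [] := Hk1 n.
exists T, x, y, p, q; split => //; split; [split|split; [|split]] => //.
- apply: (end0 X_); first by move=> n; have [] := ends n.
  exact: (flim_seq U_oo XB XL r0 n0 pos0).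
- apply: (end0 Y_); first by move=> n; have [] := ends n.
  exact: (flim_seq U_oo YB YL r0 n0 pos0).
- apply: (end1 X_) => //; first by move=> n; have [] := ends n.
  exact: (flim_seq U_oo XB XL r1 nn pos1).
- apply: (end1 Y_) => //; first by move=> n; have [] := ends n.
  exact: (flim_seq U_oo YB YL r1 nn pos1).
- by move=> t t01; split; [exact: xder|exact: yder|exact: pder|exact: qder].
- by move=> t t01; rewrite -Ec; exact: Ecst2.
Qed.

End LimitOrbit.

(** * Classical and weak derivatives *)

Section WeakDerivative.
Variable R : realType.
Implicit Types u g : R -> R.

Local Notation leb := (@lebesgue_measure R).

Lemma continuous_integrable01 u : continuous u ->
  leb.-integrable `[0, 1] (EFin \o u).
Proof.
move=> cu; apply: continuous_compact_integrable; first exact: segment_compact.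
exact: continuous_subspaceT.
Qed.

Lemma itv01_sub : (`]0, 1[ : set R) `<=` `[0, 1].
Proof. by move=> t; rewrite /= !in_itv/= => /andP[/ltW -> /ltW ->]. Qed.

Lemma continuous_integrable01o u : continuous u ->
  leb.-integrable `]0, 1[ (EFin \o u).
Proof.
move=> cu; apply: (@integrableS _ _ R leb `[0, 1] `]0, 1[) => //.
  exact: itv01_sub.
exact: continuous_integrable01.
Qed.

Lemma Rintegral01 u : continuous u ->
  \int[leb]_(t in `]0, 1[) u t = \int[leb]_(t in `[0, 1]) u t.
Proof.
move=> cu; rewrite Rintegral_itv_obnd_cbnd; last exact: continuous_integrable01o.
rewrite Rintegral_itv_bndo_bndc//.
apply: (@integrableS _ _ R leb `[0, 1] `[0, 1[) => //.
  by move=> t; rewrite /= !in_itv/= => /andP[-> /ltW ->].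
exact: continuous_integrable01.
Qed.

Lemma continuous_locally_integrable01 u : continuous u ->
  locally_integrable `]0, 1[ u.
Proof.
by move=> cu; apply: open_integrable_locally; [exact: itv_open|exact: continuous_integrable01o].
Qed.

(** Integration by parts on the closed interval. The boundary terms vanish because [phi] is
    supported in the open one, and continuity on the whole line makes the two integrals agree. *)
Lemma classical_weak_derivative01 u g : continuous u -> continuous g ->
  (forall t : R, 0 < t < 1 -> is_derive t 1 u (g t)) -> weak_derivative01 u g.
Proof.
move=> cu cg ug; split; [exact: continuous_locally_integrable01..|].
move=> phi [phid phis].
have d1 (k : nat) : continuous (phi^`(k)%classic).
  move=> t; apply: differentiable_continuous; apply/derivable1_diffP; exact: phid.
have cphi : continuous phi := d1 0%N.
have cphi' : continuous (phi^`()%classic) := d1 1%N.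
have zero (t : R) : ~ (0 < t < 1) -> phi t = 0.
  move=> t01; apply: contrapT => /eqP pt; apply: t01.
  by have := phis t (@subset_closure _ [set t | phi t != 0] t pt); rewrite /= in_itv.
have LR (f : R -> R) : continuous f -> (forall t : R, 0 < t < 1 -> derivable f t 1) ->
    derivable_oo_LRcontinuous f 0 1.
  move=> cf df; split; first by move=> t; rewrite in_itv/=; exact: df.
    exact/cvg_at_right_filter/cf.
  exact/cvg_at_left_filter/cf.
have cM (f h : R -> R) : continuous f -> continuous h -> continuous (fun t => f t * h t).
  by move=> cf ch t; apply: cvgM; [exact: cf|exact: ch].
rewrite !Rintegral01; [|exact: cM..].
rewrite (@Rintegration_by_parts _ u phi g (phi^`()%classic))//.
- by rewrite !zero ?ltxx ?andbF// !mulr0 subrr sub0r.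
- exact: continuous_subspaceT.
- by apply: LR => // t /ug [].
- by move=> t; rewrite in_itv/= => /ug [_ <-]; rewrite derive1E.
- exact: continuous_subspaceT.
- by apply: LR => // t _; exact: (phid 0%N).
Qed.

Lemma continuous_L2_01 u : continuous u -> L2_01 u.
Proof.
move=> cu; split.
  by apply: measurable_realfun.open_continuous_measurable_fun; [exact: itv_open|move=> t _; exact: cu].
have c2 : continuous (fun t => u t ^+ 2).
  by move=> t; rewrite /continuous_at expr2; apply: cvgM; exact: cu.
have /integrableP[_] := continuous_integrable01o c2.
apply: le_lt_trans; rewrite le_eqVlt; apply/orP; left; apply/eqP.
by apply: eq_integral => t _; rewrite /= ger0_norm// sqr_ge0.
Qed.

Lemma classical_W12_01 u g : continuous u -> continuous g ->
  (forall t : R, 0 < t < 1 -> is_derive t 1 u (g t)) -> W12_01 u.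
Proof.
move=> cu cg ug; split; first exact: continuous_L2_01.
exists g; split; first exact: continuous_L2_01.
exact: classical_weak_derivative01.
Qed.

End WeakDerivative.

(** * Confinement to the disc *)

Section Confinement.
Variables (R : realType) (Wx Wy : R -> R -> R) (T rho : R) (x y p q : R -> R).
Hypotheses (T_gt0 : 0 < T) (cx : continuous x) (cy : continuous y).
Hypothesis ode : forall t : R, 0 < t < 1 ->
   [/\ is_derive t 1 x (T * (p t + y t)), is_derive t 1 y (T * (q t - x t)),
      is_derive t 1 p (T * (q t + Wx (x t) (y t))) &
      is_derive t 1 q (T * (- p t + Wy (x t) (y t)))].
Hypothesis outward : forall t : R, 0 <= t <= 1 -> rho < x t ^+ 2 + y t ^+ 2 ->
  0 < p t ^+ 2 + q t ^+ 2 + x t * Wx (x t) (y t) + y t * Wy (x t) (y t).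
Hypotheses (start_le : x 0 ^+ 2 + y 0 ^+ 2 <= rho)
  (end_le : x 1 ^+ 2 + y 1 ^+ 2 <= rho).

(* At an interior maximum of [|q|^2] outside the disc, [q.p] would vanish and increase. *)
Lemma confined (t : R) : 0 <= t <= 1 -> x t ^+ 2 + y t ^+ 2 <= rho.
Proof.
pose r t := x t ^+ 2 + y t ^+ 2; pose s t := x t * p t + y t * q t.
have rder (z : R) : 0 < z < 1 -> is_derive z 1 r (2 * T * s z).
  move=> /ode[dx dy _ _]; rewrite /r; apply: is_derive_eq; rewrite /GRing.scale/= /s; ring.
have sder (z : R) : 0 < z < 1 -> is_derive z 1 s
    (T * (p z ^+ 2 + q z ^+ 2 + x z * Wx (x z) (y z) + y z * Wy (x z) (y z))).
  move=> /ode[dx dy dp dq]; rewrite /s; apply: is_derive_eq; rewrite /GRing.scale/=; ring.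
have cr : continuous r.
  move=> z; apply: cvgD; rewrite expr2; apply: cvgM; (exact: cx || exact: cy).
have [||m m01 mmax] := @EVT_max R r 0 1; [exact: ler01|exact: continuous_subspaceT|].
move=> t01; apply: le_trans (mmax t _) _; first by rewrite in_itv.
rewrite leNgt; apply/negP => rm; have m01' : 0 <= m <= 1 by rewrite in_itv/= in m01.
have m0 : m != 0 by apply/eqP => m0; move: rm; rewrite m0 /r ltNge start_le.
have m1 : m != 1 by apply/eqP => m1; move: rm; rewrite m1 /r ltNge end_le.
have {}m01 : 0 < m < 1.
  by have /andP[ma mb] := m01'; rewrite !lt_neqAle [0 == m]eq_sym m0 m1 ma mb.
have s0 : s m = 0.
  have [_ d0] : is_derive m 1 r 0.
    apply: (@derive1_at_max _ r 0 1).
    - exact: ler01.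
    - by move=> z; rewrite in_itv/= => /rder[].
    - by rewrite in_itv.
    - by move=> z zi; apply: mmax; move: zi; rewrite !in_itv/= => /andP[/ltW -> /ltW ->].
  have [_] := rder m m01; rewrite d0 => /esym/eqP.
  by rewrite mulf_eq0 mulf_eq0 pnatr_eq0 (gt_eqF T_gt0)/= => /eqP.
set K := p m ^+ 2 + q m ^+ 2 + x m * Wx (x m) (y m) + y m * Wy (x m) (y m).
have K0 : 0 < T * K by rewrite mulr_gt0//; apply: outward.
(* An error of half the slope [T * K] keeps [s] positive just after [m]; the mean value theorem then
   gives [r (m + e) > r m]. *)
have K2 : 0 < T * K / 2 by rewrite divr_gt0.
have [del del0 H] := lin_is_derive (sder m m01) K2.
have /andP[mgt0 mlt1] := m01.
pose e := Num.min (del / 2) ((1 - m) / 2).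
have e0 : 0 < e by rewrite lt_min !divr_gt0// subr_gt0.
have eD : e < del by rewrite gt_min ltr_pdivrMr// mulr2n mulrDr mulr1 ltrDl del0.
have e1 : m + e < 1.
  rewrite -ltrBrDl gt_min [X in _ || X]ltr_pdivrMr// mulr2n mulrDr mulr1.
  by rewrite ltrDl subr_gt0 mlt1 orbT.
have spos z : m < z < m + e -> 0 < s z.
  move=> /andP[mz ze]; have := H z; rewrite gtr0_norm ?subr_gt0// => /(_ _).
  have zd : z - m < del by rewrite ltrBlDl (lt_trans ze)// ltrD2l.
  move=> /(_ zd); rewrite s0 subr0 -/K ler_norml => /andP[h _].
  have z0 : 0 < z - m by rewrite subr_gt0.
  by nra.
have me : m < m + e by rewrite ltrDl.
have [z||z zi eq] := @MVT R r (fun z => 2 * T * s z) m (m + e) me.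
- rewrite in_itv/= => /andP[z1 z2]; apply: rder.
  by rewrite (lt_trans mgt0 z1) (lt_trans z2 e1).
- exact: continuous_subspaceT.
have : r (m + e) <= r m.
  by apply: mmax; rewrite in_itv/= (ltW e1) (ltW (lt_trans mgt0 me)).
rewrite -subr_le0 eq leNgt => /negP; apply.
rewrite [m + e]addrC addrK mulr_gt0// !mulr_gt0//; apply: spos.
by move: zi; rewrite in_itv.
Qed.

End Confinement.

(** * The penalty and the kinetic energy outside the disc *)

Section Penalty.
Variable R : realType.

Definition sqpos (u : R) : R := Num.max u 0 ^+ 2.

(** For each choice of signs of [s] and [t] the remainder is at most [(s - t)^2] in absolute
    value. *)
Lemma is_derive_sqpos (t : R) : is_derive t 1 sqpos (2 * Num.max t 0).
Proof.
apply: is_derive_lin => eps eps0; exists eps => // s st; rewrite /sqpos.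
apply: (@le_trans _ _ (`|s - t| * `|s - t|)); last by rewrite ler_wpM2r// ltW.
rewrite -[in leRHS]normrM (@ger0_norm _ ((s - t) * (s - t))) ?sqr_ge0//.
have h1 := sqr_ge0 s; have h2 := sqr_ge0 t; have h3 := sqr_ge0 (s - t).
have h4 := sqr_ge0 (s + t).
case: (leP t 0) => t0; case: (leP s 0) => s0; rewrite ler_norml.
- by apply/andP; split; lra.
- by have := mulr_ge0_le0 (ltW s0) t0 => h; apply/andP; split; lra.
- by have := mulr_ge0_le0 (ltW t0) s0 => h; apply/andP; split; lra.
- by apply/andP; split; lra.
Qed.

Lemma max0_continuous : continuous (fun u : R => Num.max u 0).
Proof.
move=> t; apply/cvgrPdist_le => eps eps0; exists eps => // s /= st.
apply: le_trans (ltW st); have := ler_norm (t - s); have := ler_norm (s - t).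
rewrite distrC => h1 h2; rewrite ler_norml.
by case: (leP t 0) => t0; case: (leP s 0) => s0; apply/andP; split; lra.
Qed.

(** Cauchy-Schwarz, from Lagrange's identity with [p * x + q * y] as the other square. *)
Lemma cross_le (x y p q : R) :
  p * y - q * x <= Num.sqrt (p ^+ 2 + q ^+ 2) * Num.sqrt (x ^+ 2 + y ^+ 2).
Proof.
rewrite -sqrtrM ?addr_ge0 ?sqr_ge0//.
apply: le_trans (ler_norm _) _; rewrite -sqrtr_sqr ler_wsqrtr//.
by have := sqr_ge0 (p * x + q * y); nra.
Qed.

Lemma dot_le (x y p q : R) :
  p * x + q * y <= Num.sqrt (p ^+ 2 + q ^+ 2) * Num.sqrt (x ^+ 2 + y ^+ 2).
Proof.
have := cross_le (- y) x p q; rewrite sqrrN [y ^+ 2 + _]addrC.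
by rewrite mulrN opprK.
Qed.

(** Suppose [|p|^2 <= e] at radius [R1 + z]. As [R1 >= 1], the penalty is at least [4 * K * z^2],
    and the energy equation gives [ga + 4 * K * z^2 <= sqrt e * z] with
    [ga = c - (e / 2 + sqrt e * R1)]. For [K = e / ga] the discriminant [e - 16 * K * ga] of this
    quadratic in [z] is negative. *)
Lemma kinetic_large (c e K R1 w x y p q : R) : 1 <= R1 -> 0 < e ->
  e / 2 + Num.sqrt e * R1 < c -> K = e / (c - (e / 2 + Num.sqrt e * R1)) ->
  R1 ^+ 2 < x ^+ 2 + y ^+ 2 -> K * sqpos (x ^+ 2 + y ^+ 2 - R1 ^+ 2) <= w ->
  p ^+ 2 / 2 + q ^+ 2 / 2 + p * y - q * x - w = c ->
  e < p ^+ 2 + q ^+ 2.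
Proof.
move=> R11 e0 ec Kdef rr Kw en; rewrite ltNge; apply/negP => pe.
set g := Num.sqrt e in ec Kdef.
have g0 : 0 <= g by exact: sqrtr_ge0.
have g2 : g ^+ 2 = e by rewrite sqr_sqrtr// ltW.
set ga := c - _ in Kdef; have ga0 : 0 < ga by rewrite subr_gt0.
have Kga : K * ga = e by rewrite Kdef divfK// gt_eqF.
have K0 : 0 < K by rewrite Kdef divr_gt0.
set r := Num.sqrt (x ^+ 2 + y ^+ 2).
have r2 : r ^+ 2 = x ^+ 2 + y ^+ 2 by rewrite sqr_sqrtr// addr_ge0// sqr_ge0.
have r0 : 0 <= r by exact: sqrtr_ge0.
have mg : Num.sqrt (p ^+ 2 + q ^+ 2) <= g by rewrite ler_wsqrtr.
have cr : p * y - q * x <= g * r.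
  by apply: le_trans (cross_le _ _ _ _) _; rewrite ler_wpM2r.
have R1r : R1 < r by rewrite -ltr_sqr ?r2// nnegrE (le_trans ler01).
pose z := r - R1; have z0 : 0 < z by rewrite subr_gt0.
have sq : 4 * z ^+ 2 <= sqpos (x ^+ 2 + y ^+ 2 - R1 ^+ 2).
  rewrite /sqpos max_l; last by rewrite subr_ge0 ltW.
  rewrite (_ : 4 * z ^+ 2 = (2 * z) ^+ 2); last by ring.
  rewrite ler_sqr ?nnegrE; [|by lra|by rewrite subr_ge0 ltW].
  by rewrite -r2 /z; nra.
have h1 : K * (4 * z ^+ 2) <= w by apply: le_trans Kw; rewrite ler_wpM2l// ltW.
have h2 : ga + K * (4 * z ^+ 2) <= g * z.
  have gz : g * z = g * r - g * R1 by rewrite /z mulrBr.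
  by rewrite gz /ga; lra.
have h3 : 16 * e + (8 * K * z) ^+ 2 <= 16 * K * g * z.
  rewrite -Kga (_ : 16 * (K * ga) + _ = 16 * K * (ga + K * (4 * z ^+ 2))); last by ring.
  by rewrite -[16 * K * g * z]mulrA ler_wpM2l// mulr_ge0// ltW.
have := sqr_ge0 (8 * K * z - g); rewrite sqrrB g2; lra.
Qed.

End Penalty.

(** * Radial derivative of the Kepler potentials *)

Section Kepler.
Variable R : realType.
Implicit Types x y be b : R.

(** The radial derivative is taken along the ray through the point, as a derivative in one variable.
    The centre of attraction is [(- be, 0)]. *)
Lemma kepler_derive x y be : 0 < (x + be) ^+ 2 + y ^+ 2 ->
  is_derive (1 : R) 1 (fun s : R => (Num.sqrt ((s * x + be) ^+ 2 + (s * y) ^+ 2))^-1)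
    (- ((x * (x + be) + y ^+ 2) / Num.sqrt ((x + be) ^+ 2 + y ^+ 2) ^+ 3)).
Proof.
move=> D0; set d := Num.sqrt ((x + be) ^+ 2 + y ^+ 2).
have d0 : 0 < d by rewrite sqrtr_gt0.
have E1 : (1 * x + be) ^+ 2 + (1 * y) ^+ 2 = (x + be) ^+ 2 + y ^+ 2 by rewrite !mul1r.
have iD : is_derive (1 : R) 1 (fun s : R => (s * x + be) ^+ 2 + (s * y) ^+ 2)
    (2 * (x * (x + be) + y ^+ 2)).
  by apply: is_derive_eq; rewrite /GRing.scale/=; ring.
have iS : is_derive (1 : R) 1 (fun s : R => Num.sqrt ((s * x + be) ^+ 2 + (s * y) ^+ 2))
    ((2 * d)^-1 * (2 * (x * (x + be) + y ^+ 2))).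
  apply: (@is_derive1_comp R Num.sqrt) => //.
  by rewrite /d -E1; apply: is_derive1_sqrt; rewrite E1.
apply: is_derive_eq.
  apply: (@is_deriveV _ (fun s : R => Num.sqrt ((s * x + be) ^+ 2 + (s * y) ^+ 2))
    _ _ _ _ iS); by rewrite E1 gt_eqF.
by rewrite /= E1 -/d /GRing.scale/=; field; rewrite gt_eqF.
Qed.

Lemma sqrt_sum_ge x y be b : `|be| <= b ->
  Num.sqrt (x ^+ 2 + y ^+ 2) - b <= Num.sqrt ((x + be) ^+ 2 + y ^+ 2).
Proof.
move=> beb; set r := Num.sqrt (x ^+ 2 + y ^+ 2).
have r0 : 0 <= r by exact: sqrtr_ge0.
have r2 : r ^+ 2 = x ^+ 2 + y ^+ 2 by rewrite sqr_sqrtr// addr_ge0// sqr_ge0.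
have b0 : 0 <= b := le_trans (normr_ge0 _) beb.
have [rb|rb] := leP (r - b) 0; first exact: le_trans rb (sqrtr_ge0 _).
apply: (@le_trans _ _ (r - `|be|)); first by rewrite lerD2l lerN2.
have rbe : 0 <= r - `|be| by lra.
rewrite -(ger0_norm rbe) -sqrtr_sqr ler_wsqrtr//.
have xr : `|x| <= r by rewrite -sqrtr_sqr ler_wsqrtr// lerDl sqr_ge0.
have : - (x * be) <= r * `|be|.
  by apply: le_trans (ler_norm _) _; rewrite normrN normrM ler_wpM2r.
by rewrite sqrrB real_normK ?num_real// r2 sqrrD; lra.
Qed.

(** Cauchy-Schwarz bounds the quotient by [r / d^2], for the distances [r] to the origin and [d] to
    the centre. From [d >= r - b] and [2 * b <= R1 < r] follow [r <= 2 * d] and [R1 - b <= d]. *)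
Lemma kepler_bound x y be b (R1 : R) : `|be| <= b -> 2 * b <= R1 -> 0 < R1 ->
  R1 ^+ 2 < x ^+ 2 + y ^+ 2 ->
  0 < (x + be) ^+ 2 + y ^+ 2 /\
  (x * (x + be) + y ^+ 2) / Num.sqrt ((x + be) ^+ 2 + y ^+ 2) ^+ 3 <= 2 / (R1 - b).
Proof.
move=> beb bR R10 rR; have ds := @sqrt_sum_ge x y be b beb.
set r := Num.sqrt (x ^+ 2 + y ^+ 2) in ds.
set d := Num.sqrt ((x + be) ^+ 2 + y ^+ 2) in ds *.
have r0 : 0 <= r by exact: sqrtr_ge0.
have r2 : r ^+ 2 = x ^+ 2 + y ^+ 2 by rewrite sqr_sqrtr// addr_ge0// sqr_ge0.
have R1r : R1 < r by rewrite -ltr_sqr ?r2// nnegrE ltW.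
have b0 : 0 <= b := le_trans (normr_ge0 _) beb.
have d0 : 0 < d by lra.
split; first by rewrite -sqrtr_gt0.
have := @dot_le R x y (x + be) y; rewrite -/r -/d => h.
apply: (@le_trans _ _ (r / d ^+ 2)).
  rewrite ler_pdivrMr ?exprn_gt0// (_ : r / d ^+ 2 * d ^+ 3 = d * r); last first.
    by field; rewrite gt_eqF.
  by apply: le_trans h; rewrite -expr2 [x * _]mulrC.
have Rb : 0 < R1 - b by lra.
rewrite ler_pdivrMr ?exprn_gt0// mulrAC ler_pdivlMr//.
have h1 : r <= 2 * d by lra.
have h2 : R1 - b <= d by lra.
apply: (@le_trans _ _ ((2 * d) * d)); first by apply: ler_pM => //; exact: ltW.
by rewrite expr2 mulrA.
Qed.

Lemma polar_surj x y : 0 < x ^+ 2 + y ^+ 2 ->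
  exists th, x = Num.sqrt (x ^+ 2 + y ^+ 2) * cos th /\
             y = Num.sqrt (x ^+ 2 + y ^+ 2) * sin th.
Proof.
move=> D0; set r := Num.sqrt _; have r0 : 0 < r by rewrite sqrtr_gt0.
have r2 : r ^+ 2 = x ^+ 2 + y ^+ 2 by rewrite sqr_sqrtr// ltW.
have xr : `|x| <= r by rewrite -sqrtr_sqr ler_wsqrtr// lerDl sqr_ge0.
have h : -1 <= x / r <= 1 by rewrite -ler_norml normrM normfV (gtr0_norm r0) ler_pdivrMr// mul1r.
have cosE : r * cos (acos (x / r)) = x.
  by rewrite acosK ?in_itv//= mulrC divfK// gt_eqF.
have sinE : r * sin (acos (x / r)) = `|y|.
  have rx : r * (x / r) = x by rewrite mulrC divfK// gt_eqF.
  rewrite sin_acos// -[RHS]sqrtr_sqr (_ : y ^+ 2 = r ^+ 2 * (1 - (x / r) ^+ 2)).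
    by rewrite sqrtrM ?sqr_ge0// sqrtr_sqr gtr0_norm.
  by rewrite mulrBr mulr1 -exprMn rx r2; ring.
have [y0|y0] := leP 0 y.
  by exists (acos (x / r)); rewrite cosE sinE ger0_norm.
exists (- acos (x / r)); rewrite cosN sinN cosE mulrN sinE ltr0_norm//.
by rewrite opprK.
Qed.

End Kepler.

(** * The potential in Cartesian coordinates *)

Section PlanarPotential.
Variables (R : realType) (V : 'rV[R]_2 -> R).
Hypothesis V_smooth : smooth V.

Definition vec2 (x y : R) : 'rV[R]_2 := \row_(i < 2) (if i == 0 then x else y).

Lemma vec2E (q : 'rV[R]_2) : q = vec2 (q 0 0) (q 0 1).
Proof.
apply/rowP => i; rewrite mxE; have [->//|i0] := eqVneq i 0.
by congr (q 0 _); apply/val_inj; case: i i0 => -[|[|[]]].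
Qed.

Lemma vec2_cvg (x y : R) : vec2 z.1 z.2 @[z --> (x, y)] --> vec2 x y.
Proof.
move=> A /nbhs_ballP[e /= e0 eA]; apply/nbhs_ballP; exists e => // -[x' y'] [/= hx hy].
by apply: eA; split => // i j; rewrite !mxE; case: ifP.
Qed.

Lemma vec2_comp_cvg (f : 'rV[R]_2 -> R) (x y : R) : continuous f ->
  f (vec2 z.1 z.2) @[z --> (x, y)] --> f (vec2 x y).
Proof. by move=> cf; apply: (cvg_comp _ _ (@vec2_cvg x y)); exact: cf. Qed.

Lemma vec2_shift0 (h x y : R) : h *: delta_mx 0 0 + vec2 x y = vec2 (h + x) y.
Proof. by apply/rowP => i; rewrite !mxE; case: (i == 0); rewrite ?mulr1 ?mulr0 ?add0r. Qed.

Lemma vec2_shift1 (h x y : R) : h *: delta_mx 0 1 + vec2 x y = vec2 x (h + y).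
Proof.
apply/rowP => i; rewrite !mxE; case: i => -[|[|//]] i2 /=; by rewrite ?mulr1 ?mulr0 ?add0r.
Qed.

Lemma partial0_is_derive (x y : R) :
  is_derive x 1 (fun s => V (vec2 s y)) (partial 0 V (vec2 x y)).
Proof.
have [_ /(_ 0)[/(_ (vec2 x y)) + _]] := V_smooth 1.
rewrite /partial /derivable /derive => dV.
have E : (fun h : R => h^-1 *: (V (h *: delta_mx 0 0 + vec2 x y) - V (vec2 x y))) =
   (fun h : R => h^-1 *: (V (vec2 (h *: 1 + x) y) - V (vec2 x y))).
  by apply/funext => h; rewrite vec2_shift0 [h *: 1]mulr1.
by apply: DeriveDef; rewrite /derivable/derive/= -?E.
Qed.

Lemma partial1_is_derive (x y : R) :
  is_derive y 1 (fun s => V (vec2 x s)) (partial 1 V (vec2 x y)).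
Proof.
have [_ /(_ 1)[/(_ (vec2 x y)) + _]] := V_smooth 1.
rewrite /partial /derivable /derive => dV.
have E : (fun h : R => h^-1 *: (V (h *: delta_mx 0 1 + vec2 x y) - V (vec2 x y))) =
   (fun h : R => h^-1 *: (V (vec2 x (h *: 1 + y)) - V (vec2 x y))).
  by apply/funext => h; rewrite vec2_shift1 [h *: 1]mulr1.
by apply: DeriveDef; rewrite /derivable/derive/= -?E.
Qed.

Lemma partial_continuous (i : 'I_2) : continuous (partial i V).
Proof. by have [_ /(_ i)[_ []]] := V_smooth 1. Qed.

Lemma V_continuous : continuous V.
Proof. by have [] := V_smooth 0. Qed.

Variable mu : R.
Hypotheses (mu_gt0 : 0 < mu) (mu_le : mu <= 1 / 2).
Hypothesis V_polar : forall r theta : R, 1 <= r ->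
  V (polar r theta) =
    (1 - mu) / Num.sqrt (r ^+ 2 + 2 * r * mu * cos theta + mu ^+ 2)
    + mu / Num.sqrt (r ^+ 2 - 2 * r * (1 - mu) * cos theta + (1 - mu) ^+ 2).

(** The primaries, of masses [1 - mu] and [mu], sit at [(- mu, 0)] and [(1 - mu, 0)]. *)
Lemma V_cartesian (x y : R) : 1 <= x ^+ 2 + y ^+ 2 ->
  V (vec2 x y) = (1 - mu) / Num.sqrt ((x + mu) ^+ 2 + y ^+ 2) +
    mu / Num.sqrt ((x - (1 - mu)) ^+ 2 + y ^+ 2).
Proof.
move=> D1; have D0 : 0 < x ^+ 2 + y ^+ 2 by exact: lt_le_trans D1.
have [th] := polar_surj D0; set r := Num.sqrt _ => -[xE yE].
have r2 : r ^+ 2 = x ^+ 2 + y ^+ 2 by rewrite sqr_sqrtr// ltW.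
have r1 : 1 <= r by rewrite -sqrtr1 ler_wsqrtr.
rewrite (_ : vec2 x y = polar r th); last by rewrite /vec2 /polar -xE -yE.
rewrite V_polar//; congr (_ / Num.sqrt _ + _ / Num.sqrt _); rewrite r2.
  have -> : 2 * r * mu * cos th = 2 * mu * x by rewrite [in RHS]xE; ring.
  by ring.
have -> : 2 * r * (1 - mu) * cos th = 2 * (1 - mu) * x by rewrite [in RHS]xE; ring.
by ring.
Qed.

(** The derivative of [V (s q)] in [s] at [s = 1] is computed twice, by the chain rule and from the
    explicit formula; [kepler_bound] estimates the second result. *)
Lemma radial_derivative_ge (R1 x y : R) : 2 * (1 - mu) <= R1 ->
  R1 ^+ 2 < x ^+ 2 + y ^+ 2 ->
  - ((1 - mu) * (2 / (R1 - mu)) + mu * (2 / (R1 - (1 - mu)))) <=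
    x * partial 0 V (vec2 x y) + y * partial 1 V (vec2 x y).
Proof.
move=> R1mu rR; have R11 : 1 <= R1 by have := mu_le; lra.
have R1sq : 1 <= R1 ^+ 2 by rewrite expr_ge1// (le_trans ler01).
have r1 : 1 < x ^+ 2 + y ^+ 2 := le_lt_trans R1sq rR.
have R10 : 0 < R1 by lra.
have m1 : `|mu| <= mu by rewrite gtr0_norm.
have m2 : `|- (1 - mu)| <= 1 - mu by rewrite normrN ger0_norm//; have := mu_le; lra.
have m3 : 2 * mu <= R1 by have := mu_le; lra.
have [D1 B1] := kepler_bound m1 m3 R10 rR; have [D2 B2] := kepler_bound m2 R1mu R10 rR.
have k1 := kepler_derive D1; have k2 := kepler_derive D2.
have dV : is_derive (1 : R) 1 (fun s : R => V (vec2 (s * x) (s * y)))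
   (partial 0 V (vec2 (1 * x) (1 * y)) * x + partial 1 V (vec2 (1 * x) (1 * y)) * y).
  apply: (@is_derive_chain2 R (fun x y => V (vec2 x y))
    (fun x y => partial 0 V (vec2 x y)) (fun x y => partial 1 V (vec2 x y))
    (fun s => s * x) (fun s => s * y) 1 x y).
  - by move=> u v; exact: partial0_is_derive.
  - by move=> u v; exact: partial1_is_derive.
  - by apply: (@vec2_comp_cvg (partial 0 V)); exact: partial_continuous.
  - by apply: (@vec2_comp_cvg (partial 1 V)); exact: partial_continuous.
  - by apply: is_derive_eq; rewrite /GRing.scale/=; ring.
  - by apply: is_derive_eq; rewrite /GRing.scale/=; ring.
have dK : is_derive (1 : R) 1 (fun s : R => V (vec2 (s * x) (s * y)))
   ((1 - mu) * - ((x * (x + mu) + y ^+ 2) / Num.sqrt ((x + mu) ^+ 2 + y ^+ 2) ^+ 3) +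
    mu * - ((x * (x + - (1 - mu)) + y ^+ 2) /
       Num.sqrt ((x + - (1 - mu)) ^+ 2 + y ^+ 2) ^+ 3)).
  apply: (@near_eq_is_derive _ _ _ (fun s : R =>
    (1 - mu) * (Num.sqrt ((s * x + mu) ^+ 2 + (s * y) ^+ 2))^-1 +
    mu * (Num.sqrt ((s * x + - (1 - mu)) ^+ 2 + (s * y) ^+ 2))^-1)).
  have cs : (s * x) ^+ 2 + (s * y) ^+ 2 @[s --> (1 : R)] --> x ^+ 2 + y ^+ 2.
    rewrite -{2}[x]mul1r -{2}[y]mul1r.
    by apply: cvgD; rewrite expr2; apply: cvgM; apply: cvgM => //; exact: cvg_cst.
  (* The explicit formula is available where [|q| >= 1]. As [|q| > R1 >= 1], it holds along the ray
     for all [s] near 1. *)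
  have : \forall s \near (1 : R), 1 < (s * x) ^+ 2 + (s * y) ^+ 2 by exact: (cvgr_gt _ cs).
  by apply: filterS => s /ltW /V_cartesian ->.
have [_ e1] := dV; have [_ e2] := dK.
have -> : x * partial 0 V (vec2 x y) + y * partial 1 V (vec2 x y) =
  (1 - mu) * - ((x * (x + mu) + y ^+ 2) / Num.sqrt ((x + mu) ^+ 2 + y ^+ 2) ^+ 3) +
    mu * - ((x * (x + - (1 - mu)) + y ^+ 2) /
       Num.sqrt ((x + - (1 - mu)) ^+ 2 + y ^+ 2) ^+ 3).
  by rewrite -e2 e1 !mul1r mulrC [y * _]mulrC.
have mu1 : 0 <= 1 - mu by have := mu_le; lra.
by rewrite !mulrN -opprD lerN2; apply: lerD; apply: ler_wpM2l => //; exact: ltW.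
Qed.

End PlanarPotential.

(** * Orbits in the disc *)

Section DiscOrbit.
Variables (R : realType) (mu : R) (V : 'rV[R]_2 -> R).
Hypotheses (mu_gt0 : 0 < mu) (mu_le : mu <= 1 / 2).
Hypotheses (V_smooth : smooth V) (V_ge0 : forall q, 0 <= V q).
Hypothesis V_polar : forall r theta : R, 1 <= r ->
  V (polar r theta) =
    (1 - mu) / Num.sqrt (r ^+ 2 + 2 * r * mu * cos theta + mu ^+ 2)
    + mu / Num.sqrt (r ^+ 2 - 2 * r * (1 - mu) * cos theta + (1 - mu) ^+ 2).
Variables (R1 a c : R).
Hypothesis R1_ge : 2 * (1 - mu) <= R1.
Hypothesis a_def : a = (1 - mu) * R1 / (R1 - mu) + mu * R1 / (R1 - (1 - mu)).
Hypothesis c_gt0 : 0 < c.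
Hypothesis c_sqr : 12 * a * R1 <= c ^+ 2.

Local Notation e := (2 * a / R1).

Lemma R1_ge1 : 1 <= R1. Proof. by have := mu_le; have := R1_ge; lra. Qed.

(** [a] is the mean, with weights [1 - mu] and [mu], of two quotients that are at most 2 because
    [R1 >= 2 * (1 - mu) >= 2 * mu]. *)
Lemma a_bounds : 0 < a <= 2.
Proof.
have h1 := R1_ge1; have h2 := mu_le; have h3 := R1_ge; have h4 := mu_gt0.
have p1 : 0 < R1 - mu by lra.
have p2 : 0 < R1 - (1 - mu) by lra.
have q1 : 0 < R1 / (R1 - mu) <= 2.
  by rewrite divr_gt0 ?ler_pdivrMr//=; lra.
have q2 : 0 < R1 / (R1 - (1 - mu)) <= 2.
  by rewrite divr_gt0 ?ler_pdivrMr//=; lra.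
move: q1 q2 => /andP[q1 q1'] /andP[q2 q2'].
rewrite a_def -[_ * _ / _]mulrA -[mu * _ / _]mulrA; apply/andP; split.
  by rewrite addr_gt0// mulr_gt0//; lra.
by nra.
Qed.

Lemma e_gt0 : 0 < e.
Proof.
have /andP[a0 _] := a_bounds.
by rewrite divr_gt0 ?mulr_gt0// (lt_le_trans _ R1_ge1).
Qed.

Lemma eE : e = (1 - mu) * (2 / (R1 - mu)) + mu * (2 / (R1 - (1 - mu))).
Proof.
have h1 := R1_ge1; have h2 := mu_le; have h3 := R1_ge; have h4 := mu_gt0.
rewrite a_def; field; apply/and3P; split; rewrite gt_eqF//; lra.
Qed.

(** With [g = sqrt e * R1] one has [g^2 = 2 * a * R1], and [e / 2 <= a <= g] because [a <= 2] and
    [R1 >= 1]. So the left side is at most [2 * g], whose square [8 * a * R1] is below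
    [12 * a * R1]. *)
Lemma energy_gap : e / 2 + Num.sqrt e * R1 < c.
Proof.
have h1 := R1_ge1; have /andP[a0 a2] := a_bounds; have e0 := e_gt0.
have R10 : 0 < R1 by lra.
set g := Num.sqrt e * R1.
have g0 : 0 < g by rewrite mulr_gt0// sqrtr_gt0.
have g2 : g ^+ 2 = 2 * a * R1.
  by rewrite exprMn sqr_sqrtr ?ltW//; field; rewrite gt_eqF.
have eR : e * R1 = 2 * a by field; rewrite gt_eqF.
have eg : e / 2 <= g.
  have e2 : e / 2 <= a by rewrite ler_pdivrMr//; nra.
  have ag : a ^+ 2 <= g ^+ 2.
    by rewrite g2 expr2 -mulrA mulrCA ler_pM2l//; lra.
  move: ag; rewrite ler_sqr ?nnegrE ?(ltW a0) ?(ltW g0)//.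
  exact: le_trans e2.
apply: (@le_lt_trans _ _ (2 * g)); first by lra.
rewrite -ltr_sqr ?nnegrE; [|by lra|exact: ltW].
apply: lt_le_trans c_sqr; rewrite exprMn g2.
by have := mulr_gt0 a0 R10; lra.
Qed.

Let K := e / (c - (e / 2 + Num.sqrt e * R1)).

Lemma K_gt0 : 0 < K.
Proof. by rewrite divr_gt0 ?e_gt0// subr_gt0 energy_gap. Qed.

Let Vx x y := partial 0 V (vec2 x y).
Let Vy x y := partial 1 V (vec2 x y).
Let out (x y : R) : R := x ^+ 2 + y ^+ 2 - R1 ^+ 2.

(* [V] is changed only outside the disc, in such a way that it stays [C^1]. *)
Let W x y := V (vec2 x y) + K * sqpos (out x y).
Let Wx x y := Vx x y + K * (2 * Num.max (out x y) 0 * (2 * x)).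
Let Wy x y := Vy x y + K * (2 * Num.max (out x y) 0 * (2 * y)).

Lemma out_cvg (x y : R) : out z.1 z.2 @[z --> (x, y)] --> out x y.
Proof.
apply: cvgB; last exact: cvg_cst.
by apply: cvgD; rewrite expr2; apply: cvgM; (exact: cvg_fst || exact: cvg_snd).
Qed.

Lemma max_out_cvg (x y : R) :
  Num.max (out z.1 z.2) 0 @[z --> (x, y)] --> Num.max (out x y) 0.
Proof.
apply: (@cvg_comp _ _ _ (fun z : R * R => out z.1 z.2) (fun u => Num.max u 0)
  _ _ _ (@out_cvg x y)); exact: max0_continuous.
Qed.

Lemma exists_orbit_in_disc (a0 b0 a1 b1 : R) : (a0 != a1) || (b0 != b1) ->
  a0 ^+ 2 + b0 ^+ 2 <= R1 ^+ 2 -> a1 ^+ 2 + b1 ^+ 2 <= R1 ^+ 2 ->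
  exists (T : R) (x y p q : R -> R),
  [/\ continuous x, continuous y, continuous p & continuous q] /\
  [/\ x 0 = a0, y 0 = b0, x 1 = a1 & y 1 = b1] /\
  (forall t : R, 0 < t < 1 ->
   [/\ is_derive t 1 x (T * (p t + y t)), is_derive t 1 y (T * (q t - x t)),
      is_derive t 1 p (T * (q t + Vx (x t) (y t))) &
      is_derive t 1 q (T * (- p t + Vy (x t) (y t)))]) /\
  (forall t : R, 0 <= t <= 1 ->
    p t ^+ 2 / 2 + q t ^+ 2 / 2 + p t * y t - q t * x t - V (vec2 (x t) (y t)) = c /\
    x t ^+ 2 + y t ^+ 2 <= R1 ^+ 2).
Proof.
move=> neq start_le end_le; have K0 := K_gt0.
have Wx_der (x y : R) : is_derive x 1 (W ^~ y) (Wx x y).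
  have d1 := partial0_is_derive V_smooth x y.
  have d2 : is_derive x 1 (out ^~ y) (2 * x).
    by rewrite /out; apply: is_derive_eq; rewrite /GRing.scale/=; ring.
  have d3 := @is_derive1_comp R (@sqpos R) (out ^~ y) x _ _ (is_derive_sqpos (out x y)) d2.
  exact: (is_deriveD d1 (is_deriveZ K d3)).
have Wy_der (x y : R) : is_derive y 1 (W x) (Wy x y).
  have d1 := partial1_is_derive V_smooth x y.
  have d2 : is_derive y 1 (out x) (2 * y).
    by rewrite /out; apply: is_derive_eq; rewrite /GRing.scale/=; ring.
  have d3 := @is_derive1_comp R (@sqpos R) (out x) y _ _ (is_derive_sqpos (out x y)) d2.
  exact: (is_deriveD d1 (is_deriveZ K d3)).
have W_cont (x y : R) : W z.1 z.2 @[z --> (x, y)] --> W x y.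
  apply: cvgD; first by apply: vec2_comp_cvg; exact: V_continuous.
  apply: cvgM; first exact: cvg_cst.
  by rewrite /sqpos expr2; apply: cvgM; exact: max_out_cvg.
have Wx_cont (x y : R) : Wx z.1 z.2 @[z --> (x, y)] --> Wx x y.
  apply: cvgD; first by apply: (@vec2_comp_cvg R (partial 0 V)); exact: partial_continuous.
  apply: cvgM; first exact: cvg_cst.
  apply: cvgM; first by apply: cvgM; [exact: cvg_cst|exact: max_out_cvg].
  by apply: cvgM; [exact: cvg_cst|exact: cvg_fst].
have Wy_cont (x y : R) : Wy z.1 z.2 @[z --> (x, y)] --> Wy x y.
  apply: cvgD; first by apply: (@vec2_comp_cvg R (partial 1 V)); exact: partial_continuous.
  apply: cvgM; first exact: cvg_cst.
  apply: cvgM; first by apply: cvgM; [exact: cvg_cst|exact: max_out_cvg].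
  by apply: cvgM; [exact: cvg_cst|exact: cvg_snd].
have sq0 u : 0 <= sqpos u :> R by exact: sqr_ge0.
have W_ge0 (x y : R) : 0 <= W x y by rewrite addr_ge0// mulr_ge0// ltW.
(* This constant comes from [|x| <= (|q|^2 + 1) / 2] and, for [u = |q|^2 - R1^2] positive, from
   [u <= K * u^2 + K^-1]. *)
pose C0 := 1 + R1 ^+ 2 + K^-1.
have KV0 : 0 < K^-1 by rewrite invr_gt0.
have C0_ge0 : 0 <= C0 by rewrite !addr_ge0 ?sqr_ge0// ltW.
have young (u : R) : 0 < u -> u <= K * u ^+ 2 + K^-1.
  move=> u0; rewrite -(ler_pM2l K0) mulrDr mulfV ?gt_eqF//.
  by have := sqr_ge0 (K * u - 1); have := mulr_gt0 K0 u0; nra.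
have coer (x y : R) : (x ^+ 2 + y ^+ 2 + 1) / 2 <= W x y + C0.
  have v0 := V_ge0 (vec2 x y); rewrite /W /C0.
  have R0 := sqr_ge0 R1; have -> : x ^+ 2 + y ^+ 2 = out x y + R1 ^+ 2 by rewrite /out; ring.
  rewrite /sqpos; move: (out x y) (V _) v0 => u v v0; have [u0|u0] := leP u 0.
    by rewrite expr0n/= mulr0; lra.
  by have := young u u0; lra.
have abs_le (x y : R) : `|x| <= (x ^+ 2 + y ^+ 2 + 1) / 2.
  rewrite ler_pdivlMr// -(real_normK (num_real x)).
  by have := sqr_ge0 (`|x| - 1); have := sqr_ge0 y; nra.
have xW (x y : R) : `|x| <= W x y + C0 := le_trans (abs_le x y) (coer x y).
have yW (x y : R) : `|y| <= W x y + C0.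
  by apply: le_trans (coer x y); rewrite [x ^+ 2 + _]addrC.
have [T [x [y [p [q [[cx cy cp cq] [[x0 y0 x1 y1] [ode [en T0]]]]]]]]] :=
  exists_orbit Wx_der Wy_der W_cont Wx_cont Wy_cont W_ge0 c_gt0 C0_ge0 xW yW neq.
have inside (t : R) : 0 <= t <= 1 -> x t ^+ 2 + y t ^+ 2 <= R1 ^+ 2.
  apply: (confined T0 cx cy ode); rewrite ?x0 ?y0 ?x1 ?y1//.
  move=> s s01 rs; have h := en s s01.
  have Kw : K * sqpos (x s ^+ 2 + y s ^+ 2 - R1 ^+ 2) <= W (x s) (y s).
    by rewrite /W lerDr.
  have big := kinetic_large R1_ge1 e_gt0 energy_gap erefl rs Kw h.
  have := radial_derivative_ge V_smooth mu_gt0 mu_le V_polar R1_ge rs; rewrite -eE => rad.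
  (* The radial derivative of the penalty is nonnegative, so it only adds to the estimate for
     [V]. *)
  have pen : 0 <= K * (2 * Num.max (out (x s) (y s)) 0) * (2 * (x s ^+ 2 + y s ^+ 2)).
    apply: mulr_ge0; last by rewrite mulr_ge0// addr_ge0// sqr_ge0.
    by rewrite mulr_ge0 ?(ltW K0)// mulr_ge0// le_max lexx orbT.
  rewrite (_ : _ + _ = (p s ^+ 2 + q s ^+ 2) + (x s * Vx (x s) (y s) + y s * Vy (x s) (y s))
    + K * (2 * Num.max (out (x s) (y s)) 0) * (2 * (x s ^+ 2 + y s ^+ 2))); last first.
    by rewrite /Wx /Wy; ring.
  by apply: ltr_wpDr => //; rewrite /Vx /Vy; lra.
(* In the disc the penalty and its gradient vanish, so the orbit solves the equations for [V]. *)
have max0 (t : R) : 0 <= t <= 1 -> Num.max (out (x t) (y t)) 0 = 0.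
  by move=> /inside h; rewrite max_r// subr_le0.
exists T, x, y, p, q; split; [by []|split; [by []|split]].
- move=> t t01; have t01' : 0 <= t <= 1 by case/andP: t01 => /ltW -> /ltW ->.
  have [] := ode t t01; rewrite /Wx /Wy (max0 t t01') !mulr0 !mul0r !mulr0 !addr0.
  by split.
- move=> t t01; split; last exact: inside.
  by rewrite -[RHS](en t t01) /W /sqpos (max0 t t01) expr0n/= mulr0 addr0.
Qed.

End DiscOrbit.

(** * Hamilton's equations *)

Section HamiltonianField.
Variables (R : realType) (V : 'rV[R]_2 -> R).
Hypothesis V_smooth : smooth V.

(** Reduces the directional derivatives in [hamiltonian_vector_field] to calculus in one
    variable. *)
Lemma derive_lineE (U : normedModType R) (f : U -> R) (a v : U) (l : R) :
  is_derive (0 : R) 1 (fun h : R => f (h *: v + a)) l -> 'D_v f a = l.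
Proof.
have E : (fun h : R => h^-1 *: ((f \o shift a) (h *: v) - f a)) = (fun h : R =>
    h^-1 *: (((fun k : R => f (k *: v + a)) \o shift 0) (h *: 1) - f (0 *: v + a))).
  by apply/funext => h /=; rewrite addr0 scale0r add0r [h *: 1]mulr1.
by move=> [_ <-]; rewrite /derive E.
Qed.

Lemma hamiltonian_vec2 (x y p q : R) :
  hamiltonian V (vec2 x y, vec2 p q) =
    (p ^+ 2 + q ^+ 2) / 2 + p * y - q * x - V (vec2 x y).
Proof. by rewrite /hamiltonian !mxE. Qed.

Lemma hamiltonian_vector_field_vec2 (x y p q : R) :
  hamiltonian_vector_field (hamiltonian V) (vec2 x y, vec2 p q) =
    (vec2 (p + y) (q - x),
     vec2 (q + partial 0 V (vec2 x y)) (- p + partial 1 V (vec2 x y))).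
Proof.
have shift0 (h u w : R) : h *: (0 : 'rV[R]_2) + vec2 u w = vec2 u w by rewrite scaler0 add0r.
have line (f : R -> R) (t l : R) : is_derive t 1 f l ->
    is_derive (0 : R) 1 (fun h => f (h + t)) l.
  move=> ft; have h := @is_derive1_comp R f (fun h => h + t) 0 l 1.
  rewrite add0r mulr1 in h; apply: h => //.
  by apply: is_derive_eq; rewrite addr0.
have dVx := line _ _ _ (partial0_is_derive V_smooth x y).
have dVy := line _ _ _ (partial1_is_derive V_smooth x y).
rewrite /hamiltonian_vector_field; congr (_, _); apply/rowP => i; rewrite !mxE;
  case: i => -[|[|//]] i2 /=.
- apply: derive_lineE; rewrite (_ : (fun h : R => _) = fun h : R =>
    ((h + p) ^+ 2 + q ^+ 2) / 2 + (h + p) * y - q * x - V (vec2 x y)).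
    by apply: is_derive_eq; rewrite /GRing.scale/=; field.
  apply/funext => h; rewrite -hamiltonian_vec2; congr (hamiltonian V (_, _)).
    exact: shift0.
  by rewrite -vec2_shift0; congr (_ *: delta_mx 0 _ + _); apply/val_inj.
- apply: derive_lineE; rewrite (_ : (fun h : R => _) = fun h : R =>
    (p ^+ 2 + (h + q) ^+ 2) / 2 + p * y - (h + q) * x - V (vec2 x y)).
    by apply: is_derive_eq; rewrite /GRing.scale/=; field.
  apply/funext => h; rewrite -hamiltonian_vec2; congr (hamiltonian V (_, _)).
    exact: shift0.
  by rewrite -vec2_shift1; congr (_ *: delta_mx 0 _ + _); apply/val_inj.
- rewrite -[RHS]opprK; congr (- _); apply: derive_lineE.
  rewrite (_ : (fun h : R => _) = fun h : R =>
    (p ^+ 2 + q ^+ 2) / 2 + p * y - q * (h + x) - V (vec2 (h + x) y)).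
    by apply: is_derive_eq; rewrite /GRing.scale/=; field.
  apply/funext => h; rewrite -hamiltonian_vec2; congr (hamiltonian V (_, _)); last exact: shift0.
  by rewrite -vec2_shift0; congr (_ *: delta_mx 0 _ + _); apply/val_inj.
- rewrite -[RHS]opprK; congr (- _); apply: derive_lineE.
  rewrite (_ : (fun h : R => _) = fun h : R =>
    (p ^+ 2 + q ^+ 2) / 2 + p * (h + y) - q * x - V (vec2 x (h + y))).
    by apply: is_derive_eq; rewrite /GRing.scale/=; field.
  apply/funext => h; rewrite -hamiltonian_vec2; congr (hamiltonian V (_, _)); last exact: shift0.
  by rewrite -vec2_shift1; congr (_ *: delta_mx 0 _ + _); apply/val_inj.
Qed.

Lemma enorm_vec2 (x y : R) : enorm (vec2 x y) = Num.sqrt (x ^+ 2 + y ^+ 2).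
Proof. by rewrite /enorm !big_ord_recl big_ord0 !mxE addr0. Qed.

Lemma vec2_curve_continuous (x y : R -> R) : continuous x -> continuous y ->
  continuous (fun t => vec2 (x t) (y t)).
Proof.
move=> cx cy t; apply: (@cvg_comp _ _ _ (fun t => (x t, y t)) (fun z => vec2 z.1 z.2)
  _ (nbhs (x t, y t))); last exact: vec2_cvg.
exact: (@cvg_pair R R R (nbhs t) (nbhs (x t)) (nbhs (y t)) _ _ _ x y (cx t) (cy t)).
Qed.

Lemma curve_of_solution (q0 q1 : 'rV[R]_2) (R1 c eta : R) (x y p q : R -> R) :
  0 <= R1 ->
  continuous x -> continuous y -> continuous p -> continuous q ->
  vec2 (x 0) (y 0) = q0 -> vec2 (x 1) (y 1) = q1 ->
  (forall t : R, 0 < t < 1 ->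
   [/\ is_derive t 1 x (eta * (p t + y t)), is_derive t 1 y (eta * (q t - x t)),
      is_derive t 1 p (eta * (q t + partial 0 V (vec2 (x t) (y t)))) &
      is_derive t 1 q (eta * (- p t + partial 1 V (vec2 (x t) (y t))))]) ->
  (forall t : R, 0 <= t <= 1 ->
    p t ^+ 2 / 2 + q t ^+ 2 / 2 + p t * y t - q t * x t - V (vec2 (x t) (y t)) = c /\
    x t ^+ 2 + y t ^+ 2 <= R1 ^+ 2) ->
  exists (v : R -> cotangent R) (eta : R),
    W12_curve v /\
    curve_weak_derivative v
      (fun t => eta *: hamiltonian_vector_field (hamiltonian V) (v t)) /\
    v @` `[0, 1] `<=` hamiltonian V @^-1` [set c] /\
    cotangent_over [set q0] (v 0) /\
    cotangent_over [set q1] (v 1) /\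
    v @` `[0, 1] `<=` cotangent_over (closed_eball R1).
Proof.
move=> R10 cx cy cp cq start stop ode en.
pose v t : cotangent R := (vec2 (x t) (y t), vec2 (p t) (q t)).
have cV (i : 'I_2) : continuous (fun t => partial i V (vec2 (x t) (y t))).
  move=> t; apply: (@cvg_comp _ _ _ (fun t => vec2 (x t) (y t)) (partial i V)).
    exact: vec2_curve_continuous.
  exact: (partial_continuous V_smooth).
have cmul (f : R -> R) : continuous f -> continuous (fun t => eta * f t).
  by move=> cf t; apply: cvgM; [exact: cvg_cst|exact: cf].
have gx : continuous (fun t => eta * (p t + y t)).
  by apply: cmul => t; apply: cvgD; [exact: cp|exact: cy].
have gy : continuous (fun t => eta * (q t - x t)).
  by apply: cmul => t; apply: cvgB; [exact: cq|exact: cx].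
have gp : continuous (fun t => eta * (q t + partial 0 V (vec2 (x t) (y t)))).
  by apply: cmul => t; apply: cvgD; [exact: cq|exact: cV].
have gq : continuous (fun t => eta * (- p t + partial 1 V (vec2 (x t) (y t)))).
  by apply: cmul => t; apply: cvgD; [apply: cvgN; exact: cp|exact: cV].
have dx (t : R) : 0 < t < 1 -> is_derive t 1 x (eta * (p t + y t)) by move=> /ode[].
have dy (t : R) : 0 < t < 1 -> is_derive t 1 y (eta * (q t - x t)) by move=> /ode[].
have dp (t : R) : 0 < t < 1 ->
  is_derive t 1 p (eta * (q t + partial 0 V (vec2 (x t) (y t)))) by move=> /ode[].
have dq (t : R) : 0 < t < 1 ->
  is_derive t 1 q (eta * (- p t + partial 1 V (vec2 (x t) (y t)))) by move=> /ode[].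
have comp (i : 'I_2) (f g : R -> R) : (fun t => vec2 (f t) (g t) 0 i) = if i == 0 then f else g.
  by apply/funext => t; rewrite mxE; case: ifP.
exists v, eta; split.
  split.
    apply: continuous_subspaceT => t.
    have cxy := vec2_curve_continuous cx cy; have cpq := vec2_curve_continuous cp cq.
    exact: (@cvg_pair R _ _ (nbhs t) (nbhs (vec2 (x t) (y t))) (nbhs (vec2 (p t) (q t)))
      _ _ _ _ _ (cxy t) (cpq t)).
  move=> i; rewrite /v /= !comp; case: ifP => _; split.
  - exact: classical_W12_01 cx gx dx.
  - exact: classical_W12_01 cp gp dp.
  - exact: classical_W12_01 cy gy dy.
  - exact: classical_W12_01 cq gq dq.
split.
  move=> i; rewrite /v.
  under [X in weak_derivative01 _ X /\ _]eq_fun do rewrite hamiltonian_vector_field_vec2 /= mxE.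
  under [X in _ /\ weak_derivative01 _ X]eq_fun do rewrite hamiltonian_vector_field_vec2 /= mxE.
  rewrite /= !comp.
  have scal (f g : R -> R) : (fun t => eta * vec2 (f t) (g t) 0 i) =
      if i == 0 then (fun t => eta * f t) else (fun t => eta * g t).
    by apply/funext => t; rewrite mxE; case: ifP.
  rewrite !scal; case: ifP => _; split.
  - exact: classical_weak_derivative01 cx gx dx.
  - exact: classical_weak_derivative01 cp gp dp.
  - exact: classical_weak_derivative01 cy gy dy.
  - exact: classical_weak_derivative01 cq gq dq.
split.
  move=> _ [t /= t01 <-]; rewrite in_itv/= in t01.
  by rewrite hamiltonian_vec2 -(en t t01).1; field.
split; first exact: start.
split; first exact: stop.
move=> _ [t /= t01 <-]; rewrite in_itv/= in t01.
rewrite /cotangent_over /closed_eball /= enorm_vec2.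
by rewrite -[leRHS](ger0_norm R10) -sqrtr_sqr ler_wsqrtr// (en t t01).2.
Qed.

End HamiltonianField.

Theorem theorem1p3 (R : realType) (mu : R)
    (mu_gt0 : 0 < mu) (mu_le : mu <= 1 / 2)
    (V : 'rV[R]_2 -> R)
    (V_smooth : smooth V)
    (V_ge0 : forall q, 0 <= V q)
    (V_polar : forall r theta : R, 1 <= r ->
      V (polar r theta) =
        (1 - mu) / Num.sqrt (r ^+ 2 + 2 * r * mu * cos theta + mu ^+ 2)
        + mu / Num.sqrt (r ^+ 2 - 2 * r * (1 - mu) * cos theta
                         + (1 - mu) ^+ 2))
    (q0 q1 : 'rV[R]_2) (R1 a c : R)
    (R1_def : R1 = Num.max (2 * (1 - mu)) (Num.max (enorm q0) (enorm q1)))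
    (a_def : a = (1 - mu) * R1 / (R1 - mu) + mu * R1 / (R1 - (1 - mu)))
    (c_gt : Num.max ((32 * a ^+ 2) `^ 3^-1)
                    (Num.sqrt (4 * a * (3 * R1 + 2 * (2 * a) `^ 3^-1))) < c) :
  exists (v : R -> cotangent R) (eta : R),
    W12_curve v /\
    curve_weak_derivative v
      (fun t => eta *: hamiltonian_vector_field (hamiltonian V) (v t)) /\
    v @` `[0, 1] `<=` hamiltonian V @^-1` [set c] /\
    cotangent_over [set q0] (v 0) /\
    cotangent_over [set q1] (v 1) /\
    v @` `[0, 1] `<=` cotangent_over (closed_eball R1).
Proof.
have R1_ge : 2 * (1 - mu) <= R1 by rewrite R1_def le_max lexx.
have q0_le : enorm q0 <= R1 by rewrite R1_def !le_max lexx orbT.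
have q1_le : enorm q1 <= R1 by rewrite R1_def !le_max lexx !orbT.
have R1_ge0 : 0 <= R1 := le_trans (sqrtr_ge0 _) q0_le.
have /andP[a_gt0 _] := a_bounds mu_gt0 mu_le R1_ge a_def.
move: c_gt; rewrite gt_max => /andP[_ c_gt].
have c_gt0 : 0 < c := le_lt_trans (sqrtr_ge0 _) c_gt.
(* From [c^2 > 4 * a * (3 * R1 + 2 * w)], where [w >= 0] is the cube root of [2 * a]. *)
have c_sqr : 12 * a * R1 <= c ^+ 2.
  have w0 : 0 <= (2 * a) `^ 3^-1 by exact: powR_ge0.
  have arg0 : 0 <= 4 * a * (3 * R1 + 2 * (2 * a) `^ 3^-1).
    apply: mulr_ge0; first by rewrite mulr_ge0// ltW.
    by apply: addr_ge0; apply: mulr_ge0.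
  have : Num.sqrt (4 * a * (3 * R1 + 2 * (2 * a) `^ 3^-1)) ^+ 2 <= c ^+ 2.
    by rewrite ler_sqr ?nnegrE ?sqrtr_ge0// ltW.
  rewrite sqr_sqrtr//; apply: le_trans.
  by have := mulr_ge0 (ltW a_gt0) w0; lra.
have sq (z : 'rV[R]_2) : enorm z <= R1 -> z 0 0 ^+ 2 + z 0 1 ^+ 2 <= R1 ^+ 2.
  rewrite {1}(vec2E z) enorm_vec2 => zR.
  rewrite -[leLHS]sqr_sqrtr ?addr_ge0 ?sqr_ge0// ler_sqr ?nnegrE ?sqrtr_ge0//.
(* For equal ends the time has no positive lower bound, so the constant curve with [eta = 0] is
   taken. Its momentum is [(p0, 0)], where [p0] solves [p0^2 / 2 + p0 * y0 - V q0 = c]; the root is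
   real because [c + V q0 > 0]. *)
have [q01|q01] := eqVneq q0 q1.
  pose y0 := q0 0 1; pose p0 := - y0 + Num.sqrt (y0 ^+ 2 + 2 * (c + V q0)).
  have D0 : 0 <= y0 ^+ 2 + 2 * (c + V q0).
    by rewrite addr_ge0 ?sqr_ge0// mulr_ge0// addr_ge0// ltW.
  apply: (@curve_of_solution _ V V_smooth q0 q1 R1 c 0 (fun=> q0 0 0) (fun=> q0 0 1)
    (fun=> p0) (fun=> 0)) => //; try exact: cst_continuous.
  - by rewrite -vec2E.
  - by rewrite -vec2E.
  - by move=> t _; rewrite !mul0r; split; exact: is_derive_cst.
  - move=> t _; split; last exact: sq.
    have := sqr_sqrtr D0; rewrite -vec2E /p0 -/y0; set s := Num.sqrt _ => s2.
    by rewrite -[V q0](_ : s ^+ 2 / 2 - y0 ^+ 2 / 2 - c = _); [field|rewrite s2; field].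
have neq : (q0 0 0 != q1 0 0) || (q0 0 1 != q1 0 1).
  rewrite -negb_and; apply: contra q01 => /andP[/eqP e0 /eqP e1].
  by rewrite (vec2E q0) (vec2E q1) e0 e1.
have [T [x [y [p [q [[cx cy cp cq] [[x0 y0 x1 y1] [ode en]]]]]]]] :=
  exists_orbit_in_disc mu_gt0 mu_le V_smooth V_ge0 V_polar R1_ge a_def c_gt0 c_sqr
    neq (sq _ q0_le) (sq _ q1_le).
apply: (@curve_of_solution _ V V_smooth q0 q1 R1 c T x y p q) => //.
- by rewrite x0 y0 -vec2E.
- by rewrite x1 y1 -vec2E.
Qed.
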